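(* Let $\mathcal H$ be a complex Hilbert space, $m\ge 1$ an integer, and let $R_1,\dots,R_m,P_0$ be bounded positive operators on $\mathcal H$ such that the operators $C_i=R_i-P_0$, $i=1,\dots,m$, are trace class. Let $E$ be an orthogonal projection with $C_iE=C_i$ for all $i=1,\dots,m$. Put $$\varkappa^{\mathrm o}(\mathbf C)=\sup\Big\{\sum_{i=1}^m\operatorname{Tr}(C_iD_i)\;:\;D_i\ge 0,\ \sum_{i=1}^m D_i\le E\Big\},$$ $$\langle \mathbf C\rangle_+=\inf\{\operatorname{Tr}(BE)\;:\;B\text{ trace class},\ B\ge 0,\ B\ge C_i,\ i=1,\dots,m\}.$$ Then: (i) Operators $D_1^{\mathrm o},\dots,D_m^{\mathrm o}\ge 0$ with $D^{\mathrm o}:=\sum_{i=1}^mD_i^{\mathrm o}\le E$ attain the supremum $\varkappa^{\mathrm o}(\mathbf C)$ if and only if there is a trace class operator $B^{\mathrm o}$ with $B^{\mathrm o}\ge 0$ and $B^{\mathrm o}\ge C_i$ for $i=1,\dots,m$, such that $$B^{\mathrm o}(E-D^{\mathrm o})=0,\qquad (B^{\mathrm o}-C_i)D_i^{\mathrm o}=0,\quad i=1,\dots,m .$$ (ii) Any such $B^{\mathrm o}$ attains the infimum $\langle\mathbf C\rangle_+$; and a trace class operator $B^{\mathrm o}\ge 0$ with $B^{\mathrm o}\ge C_i$ for all $i$ attains this infimum if and only if there are $D_i^{\mathrm o}\ge0$ with $\sum_{i=1}^m D_i^{\mathrm o}\le E$ for which the equations in (i) hold. (iii) $\varkappa^{\mathrm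 o}(\mathbf C)=\langle\mathbf C\rangle_+$.
   Context: Operators are bounded linear operators on $\mathcal H$; $A\ge B$ means that $A-B$ is positive semidefinite (Hermitian). The paper writes $\langle C,D\rangle=\operatorname{Tr}(CD)$ and calls $C_i$ the degree-of-contrast operators. *)

(* Defs.v *)
From HB Require Import structures.
From mathcomp Require Import all_boot all_order all_algebra.
From mathcomp Require Import sesquilinear complex.
From mathcomp Require Import all_classical all_reals all_analysis.
From mathcomp.analysis.showcase Require Import summability.

Set Implicit Arguments.
Unset Strict Implicit.
Unset Printing Implicit Defensive.

Import Order.TTheory GRing.Theory Num.Theory.
Import numFieldNormedType.Exports.

Local Open Scope classical_set_scope.
Local Open Scope complex_scope.
Local Open Scope ring_scope.

(* [{dot H for Num.conj}] is the library's type of positive definite Hermitian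
   forms; it is linear in the first argument and antilinear in the second. *)
HB.mixin Record CompleteNormedModule_isHilbert (R : realType) H
    of CompleteNormedModule R[i] H := {
  inner : {dot H for Num.conj} ;
  inner_norm : forall x : H, inner x x = `|x| ^+ 2
}.

#[short(type="hilbertType")]
HB.structure Definition Hilbert (R : realType) :=
  {H of CompleteNormedModule_isHilbert R H & CompleteNormedModule R[i] H}.

Local Notation "''[' x , y ]" := (inner x y) : ring_scope.

Section Operators.
Variables (R : realType) (H : hilbertType R).
Implicit Types (A B T P E : H -> H) (S : set H).

(* Operators are plain functions, so that sums and differences are the pointwise
   ones of [H -> H], products are [\o], and equality is extensional. *)
Definition bounded_op A :=
  linear A /\ exists M : R, forall x, `|A x| <= M%:C * `|x|.

Definition hermitian_op A := forall x y, '[A x, y] = '[x, A y].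

(* In [R[i]], [0 <= z] means that z is real and nonnegative. *)
Definition positive_op A :=
  [/\ bounded_op A, hermitian_op A & forall x, 0 <= '[A x, x]].

Definition op_le A B := positive_op (B - A).

Definition orthogonal_projection E :=
  [/\ bounded_op E, hermitian_op E & E \o E = E].

Definition orthonormal_set S :=
  forall e f, S e -> S f -> '[e, f] = (e == f)%:R.

Definition orthonormal_basis S :=
  orthonormal_set S /\ forall x, (forall e, S e -> '[x, e] = 0) -> x = 0.

Lemma orthonormal_basis_exists : exists S, orthonormal_basis S.
Proof.
have [|S [oS maxS]] := @Zorn_bigcup H orthonormal_set.
  move=> F oF totF e f [X FX Xe] [Y FY Yf].
  have [XY|YX] := totF _ _ FX FY; first exact: (oF _ FY) (XY _ Xe) Yf.
  exact: (oF _ FX) Xe (YX _ Yf).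
exists S; split=> // x xS; apply: contrapT => /eqP x0.
have nx0 : `|x| != 0 by rewrite normr_eq0.
pose u := `|x|^-1 *: x.
have uS e : S e -> '[u, e] = 0.
  by move=> Se; rewrite linearZl_LR/= xS// mulr0.
have Su e : S e -> '[e, u] = 0.
  by move=> Se; rewrite hermC/= uS// rmorph0 mulr0.
have uu : '[u, u] = 1.
  rewrite dnormZ inner_norm -exprMn ger0_norm ?invr_ge0// mulVf//.
  by rewrite expr1n.
have NSu : ~ S u by move=> /uS; rewrite uu; exact/eqP/oner_neq0.
apply: (maxS (S `|` [set u])).
  by split=> [|sub]; [exact: subsetUl|apply: NSu; apply: sub; right].
move=> e f [Se|->] [Sf|->].
- exact: oS.
- by rewrite Su//; case: eqP => // eu; case: NSu; rewrite -eu.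
- by rewrite uS//; case: eqP => // uf; case: NSu; rewrite uf.
- by rewrite uu eqxx.
Qed.

Definition onb : set H := projT1 (cid orthonormal_basis_exists).

Lemma onbP : orthonormal_basis onb.
Proof. exact: projT2 (cid orthonormal_basis_exists). Qed.

(* P = |T|: the positive square root of T^* T *)
Definition is_absolute_value T P :=
  positive_op P /\ forall x y, '[P (P x), y] = '[T x, T y].

(* Neither trace-class membership nor the trace of a trace-class operator
   depends on the orthonormal basis chosen. *)
Definition trace_class T :=
  bounded_op T /\
  exists2 P, is_absolute_value T P &
    (\esum_(e in onb) (complex.Re '[P e, e])%:E < +oo)%E.

(* [sum] is the limit of the net of finite partial sums; no separability of [H]
   is assumed. *)
Definition Tr T : R[i] :=
  sum (fun e : onb => '[T (val e), val e] : R[i]^o).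

Variable m : nat.
Implicit Types C D : 'I_m -> H -> H.

Definition primal_feasible E D :=
  (forall i, positive_op (D i)) /\ op_le (\sum_i D i) E.

Definition dual_feasible C B :=
  [/\ trace_class B, positive_op B & forall i, op_le (C i) B].

(* The two objectives are real, since the traces involve products of two
   Hermitian operators; [complex.Re] only moves them from [R[i]] to [R]. *)
Definition primal_value C D : R := complex.Re (\sum_i Tr (C i \o D i)).

Definition dual_value E B : R := complex.Re (Tr (B \o E)).

Definition kappa_o C E : \bar R :=
  ereal_sup [set (primal_value C D)%:E | D in primal_feasible E].

Definition bracket_plus C E : \bar R :=
  ereal_inf [set (dual_value E B)%:E | B in dual_feasible C].

Definition complementary_slackness C E D B :=
  B \o (E - \sum_i D i) = 0 /\ forall i, (B - C i) \o D i = 0.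

End Operators.

(* Main.v *)
(* Weak duality and complementary slackness come from Tr (B A) >= 0 for positive B, A
   with B trace class, equality forcing B A = 0.  These facts need no square roots:
   deflating B at finitely many basis vectors (Cholesky) writes it as a finite sum of
   operators |g><g| plus a positive remainder of small trace.

   A primal optimum D exists because the constraint set is weakly compact and the
   objective, up to a uniformly small error, depends on finitely many matrix entries
   <D_i g, g>.  From D the dual optimum is explicit: B = sum_i (C_i D_i + D_i C_i) / 2
   has dual value equal to the primal value of D, and it is feasible by the first order
   condition for D along
     D_i |-> (1 - e K) D_i (1 - e K) + w_i e (2 - e |x|^2) K,   K = |x><x|,  E x = x,
   with w = 0 (giving B >= 0) or w the indicator of j (giving B >= C_j). *)

Require Import Defs.
From mathcomp Require Import all_boot all_order all_algebra.
From mathcomp Require Import sesquilinear complex finmap.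
From mathcomp Require Import all_classical all_reals all_analysis.
From mathcomp.analysis.showcase Require Import summability.
From mathcomp Require Import ring lra.

Set Implicit Arguments.
Unset Strict Implicit.
Unset Printing Implicit Defensive.

Import Order.TTheory GRing.Theory Num.Theory.
Import numFieldNormedType.Exports.

Local Open Scope classical_set_scope.
Local Open Scope complex_scope.
Local Open Scope ring_scope.

Local Notation "''[' x , y ]" := (inner x y) : ring_scope.

#[local] Existing Instance totally_filter.

(** * The real inner product *)

Section RealInner.
Variables (R : realType) (H : hilbertType R).
Implicit Types (x y z : H) (a : R).

(** Estimates are made on real parts; for complex linear operators an identity of real forms, used
    also at ['i *: y], gives back the complex one. The obstacle is that trace class membership only
    hands over [|C|], with no functional calculus or polar decomposition. The inequality [C <= |C|]
    is therefore proved by hand ([loewner]). After that each [C i] is a difference of positive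
    operators with bounded partial traces, and finite rank approximation yields even the existence
    of the traces of products. The dual candidate is read off the slackness equations: added up,
    they give [B E = sum_i C_i D_i]. This sum is not known in advance to be self-adjoint, hence the
    symmetrization. The perturbation cannot simply add a positive term to some [D i], since the
    constraint [sum_i D_i <= E] may be tight; the congruence by [1 - e K] first makes room along
    [x]. *)

Definition rip x y : R := complex.Re '[x, y].

Lemma ReD (u v : R[i]) : complex.Re (u + v) = complex.Re u + complex.Re v.
Proof. by case: u v => ? ? [? ?]. Qed.

Lemma ReN (u : R[i]) : complex.Re (- u) = - complex.Re u.
Proof. by case: u. Qed.

Lemma ReZ a (u : R[i]) : complex.Re (a%:C * u) = a * complex.Re u.
Proof. by case: u => b c /=; rewrite mul0r subr0. Qed.

Lemma innerC x y : '[x, y] = ('[y, x])^*%C.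
Proof. by rewrite hermC /= expr0 mul1r. Qed.

Lemma ripC x y : rip x y = rip y x.
Proof. by rewrite /rip innerC; case: '[y, x]. Qed.

Lemma ripDl x y z : rip (x + y) z = rip x z + rip y z.
Proof. by rewrite /rip linearDl ReD. Qed.

Lemma ripNl x z : rip (- x) z = - rip x z.
Proof. by rewrite /rip linearNl ReN. Qed.

Lemma ripZl a x z : rip (a%:C *: x) z = a * rip x z.
Proof. by rewrite /rip linearZl_LR /= ReZ. Qed.

Lemma ripDr x y z : rip z (x + y) = rip z x + rip z y.
Proof. by rewrite ripC ripDl !(ripC z). Qed.

Lemma ripNr x z : rip z (- x) = - rip z x.
Proof. by rewrite ripC ripNl ripC. Qed.

Lemma ripZr a x z : rip z (a%:C *: x) = a * rip z x.
Proof. by rewrite ripC ripZl ripC. Qed.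

Lemma rip0l x : rip 0 x = 0.
Proof. by rewrite /rip linear0l. Qed.

Lemma rip0r x : rip x 0 = 0.
Proof. by rewrite ripC rip0l. Qed.

Definition ripE := (ripDl, ripDr, ripNl, ripNr, ripZl, ripZr, rip0l, rip0r).

Lemma innerxx x : '[x, x] = (rip x x)%:C.
Proof.
have := dnorm_ge0 inner x; rewrite lecE /= => /andP[/eqP h _].
by rewrite /rip; case: '[x, x] h => u v /= ->.
Qed.

Lemma rip_ge0 x : 0 <= rip x x.
Proof. by have := dnorm_ge0 inner x; rewrite lecE /= => /andP[]. Qed.

Lemma rip_eq0 x : rip x x = 0 -> x = 0.
Proof.
move=> h; apply/eqP; rewrite -(dnorm_eq0 inner x).
by rewrite innerxx h.
Qed.

Lemma rip_inj x y : (forall z, rip x z = rip y z) -> x = y.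
Proof.
move=> h; apply/eqP; rewrite -subr_eq0; apply/eqP/rip_eq0.
by rewrite ripDl ripNl h subrr.
Qed.

Lemma ripiC x y : rip ('i *: x) y = - rip x ('i *: y).
Proof.
rewrite /rip linearZl_LR /= linearZr_LR /=.
by case: (inner x y) => a b /=; ring.
Qed.

Lemma Im_inner x y : complex.Im '[x, y] = rip x ('i *: y).
Proof.
rewrite /rip linearZr_LR /=.
by case: '[x, y] => a b /=; ring.
Qed.

Lemma inner_rip x y : '[x, y] = rip x y +i* rip x ('i *: y).
Proof. by rewrite -Im_inner /rip; case: '[x, y]. Qed.

Lemma rip_amgm x y t : 0 < t -> 2 * rip x y <= t * rip x x + t^-1 * rip y y.
Proof.
move=> t0; have := rip_ge0 (t%:C *: x - y); rewrite !ripE (ripC y x) => h.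
have tn : t != 0 by rewrite gt_eqF.
rewrite -(ler_pM2l t0).
have -> : t * (t * rip x x + t^-1 * rip y y) = t * (t * rip x x) + rip y y by field.
nra.
Qed.

Lemma norm2E x : `|x| ^+ 2 = (rip x x)%:C.
Proof. by rewrite -inner_norm innerxx. Qed.

Lemma norm_leP (M : R) x y : 0 <= M ->
  (`|x| <= M%:C * `|y|) = (rip x x <= M ^+ 2 * rip y y).
Proof.
move=> M0.
rewrite -(@ler_pXn2r _ 2) ?nnegrE ?mulr_ge0 ?normr_ge0 ?ler0c//.
by rewrite exprMn !norm2E -!rmorphXn -rmorphM lecR.
Qed.

Lemma bounded_opP (A : H -> H) : bounded_op A <->
  linear A /\ exists2 M, 0 <= M & forall x, rip (A x) (A x) <= M * rip x x.
Proof.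
split=> -[lA].
  move=> [M hM]; split => //; exists (M ^+ 2); first exact: sqr_ge0.
  move=> x; have [M0|M0] := leP 0 M; first by rewrite -norm_leP.
  have := hM x; have [->|x0] := eqVneq x 0.
    rewrite !rip0l mulr0 normr0 mulr0 normr_le0 => /eqP ->; by rewrite rip0l.
  move=> h; have M1 : M%:C * `|x| < 0 by rewrite pmulr_llt0 ?normr_gt0// ltcR.
  by have := le_lt_trans h M1; rewrite normr_lt0.
move=> [M M0 hM]; split => //; exists (Num.sqrt M) => x.
by rewrite norm_leP ?sqrtr_ge0// sqr_sqrtr.
Qed.

End RealInner.

(** * Selfadjoint and positive operators *)

Section Selfadjoint.
Variables (R : realType) (H : hilbertType R).
Implicit Types (x y z : H) (a : R) (A B P : H -> H).

Lemma linD A : linear A -> forall x y, A (x + y) = A x + A y.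
Proof. by move=> lA x y; have := lA 1 x y; rewrite !scale1r. Qed.

Lemma lin0 A : linear A -> A 0 = 0.
Proof.
by move=> lA; apply: (addrI (A 0)); rewrite -(linD lA) !addr0.
Qed.

Lemma linZ A : linear A -> forall (c : R[i]) x, A (c *: x) = c *: A x.
Proof. by move=> lA c x; have := lA c x 0; rewrite (lin0 lA) !addr0. Qed.

Lemma linN A : linear A -> forall x, A (- x) = - A x.
Proof. by move=> lA x; rewrite -scaleN1r (linZ lA) scaleN1r. Qed.

Definition linE A (lA : linear A) := (linD lA, linN lA, linZ lA, lin0 lA).

Lemma lin_sum A : linear A -> forall I (r : seq I) (p : pred I) (F : I -> H),
  A (\sum_(i <- r | p i) F i) = \sum_(i <- r | p i) A (F i).
Proof.
by move=> lA I r p F; apply: (big_morph A (linD lA) (lin0 lA)).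
Qed.

Lemma linear_add A B : linear A -> linear B -> linear (A + B).
Proof.
move=> lA lB c x y; rewrite !addrfctE !(linE lA) !(linE lB) scalerDr.
by rewrite addrACA.
Qed.

Lemma linear_scale A (c : R[i]) : linear A -> linear (fun x => c *: A x).
Proof. by move=> lA d x y; rewrite !(linE lA) scalerDr !scalerA mulrC. Qed.

Lemma linear_opp A : linear A -> linear (- A).
Proof. by move=> lA c x y; rewrite !opprfctE !(linE lA) opprD scalerN. Qed.

Lemma linear_comp A B : linear A -> linear B -> linear (A \o B).
Proof. by move=> lA lB c x y; rewrite /= !(linE lB) !(linE lA). Qed.

Definition bdd A := exists2 M, 0 <= M & forall x, rip (A x) (A x) <= M * rip x x.

Lemma rip_add_le x y : rip (x + y) (x + y) <= 2 * rip x x + 2 * rip y y.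
Proof. by have := rip_ge0 (x - y); rewrite !ripE (ripC y x); lra. Qed.

Lemma bdd_add A B : bdd A -> bdd B -> bdd (A + B).
Proof.
move=> [M M0 hM] [N N0 hN]; exists (2 * M + 2 * N); first by lra.
move=> x; rewrite addrfctE (le_trans (rip_add_le _ _))//.
by have := hM x; have := hN x; lra.
Qed.

Lemma bdd_scale A (a : R) : bdd A -> bdd (fun x => a%:C *: A x).
Proof.
move=> [M M0 hM]; exists (a ^+ 2 * M); first by rewrite mulr_ge0 ?sqr_ge0.
by move=> x; rewrite !ripE mulrA -expr2 -[leRHS]mulrA ler_wpM2l ?sqr_ge0.
Qed.

Lemma bdd_opp A : bdd A -> bdd (- A).
Proof. by move=> [M M0 hM]; exists M => // x; rewrite opprfctE !ripE opprK. Qed.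

Lemma bdd_comp A B : bdd A -> bdd B -> bdd (A \o B).
Proof.
move=> [M M0 hM] [N N0 hN]; exists (M * N); first exact: mulr_ge0.
by move=> x /=; rewrite (le_trans (hM _))// -mulrA ler_wpM2l.
Qed.

Definition selfadj A :=
  [/\ linear A, bdd A & forall x y, rip (A x) y = rip x (A y)].

Definition psd A := selfadj A /\ forall x, 0 <= rip (A x) x.

Lemma selfadjP A : bounded_op A /\ hermitian_op A <-> selfadj A.
Proof.
split=> [[/bounded_opP[lA bA] hA]|[lA bA hA]].
  by split => // x y; rewrite /rip hA.
split; first exact/bounded_opP.
by move=> x y; rewrite [LHS]inner_rip [RHS]inner_rip !hA (linZ lA).
Qed.

Lemma psdP A : positive_op A <-> psd A.
Proof.
split=> [[bA hA pA]|[sA pA]].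
  split; first exact/selfadjP.
  by move=> x; have := pA x; rewrite lecE => /andP[].
have /selfadjP[bA hA] := sA; split => // x.
(* The order of [R[i]] also asks for a zero imaginary part; by self-adjointness it equals its own
   negative. *)
rewrite lecE /= pA andbT Im_inner; case: sA => lA _ sA.
have h : rip (A x) ('i *: x) = - rip (A x) ('i *: x).
  by rewrite {1}sA (linZ lA) ripC ripiC.
by apply/eqP; lra.
Qed.

Lemma selfadj_add A B : selfadj A -> selfadj B -> selfadj (A + B).
Proof.
move=> [lA bA sA] [lB bB sB]; split; [exact: linear_add|exact: bdd_add|].
by move=> x y; rewrite !addrfctE !ripE sA sB.
Qed.

Lemma selfadj_opp A : selfadj A -> selfadj (- A).
Proof.
move=> [lA bA sA]; split; [exact: linear_opp|exact: bdd_opp|].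
by move=> x y; rewrite !opprfctE !ripE sA.
Qed.

Lemma selfadj_sub A B : selfadj A -> selfadj B -> selfadj (A - B).
Proof. by move=> sA sB; apply: selfadj_add => //; apply: selfadj_opp. Qed.

Lemma selfadj_scale A a : selfadj A -> selfadj (fun x => a%:C *: A x).
Proof.
move=> [lA bA sA]; split; [exact: linear_scale|exact: bdd_scale|].
by move=> x y; rewrite !ripE sA.
Qed.

Lemma selfadj0 : selfadj (0 : H -> H).
Proof.
split; [by move=> c x y; rewrite scaler0 addr0| |by move=> x y; rewrite !ripE].
by exists 0 => // x; rewrite !ripE mul0r.
Qed.

Lemma selfadj_id : selfadj (@id H).
Proof. by split => //; exists 1 => // x; rewrite mul1r. Qed.

Lemma selfadj_sum I (r : seq I) (p : pred I) (F : I -> H -> H) :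
  (forall i, selfadj (F i)) -> selfadj (\sum_(i <- r | p i) F i).
Proof.
by move=> sF; apply: (big_ind (@selfadj)); [exact: selfadj0|exact: selfadj_add|].
Qed.

Lemma psd_add A B : psd A -> psd B -> psd (A + B).
Proof.
move=> [sA pA] [sB pB]; split; first exact: selfadj_add.
by move=> x; rewrite addrfctE ripE addr_ge0.
Qed.

Lemma psd0 : psd (0 : H -> H).
Proof. by split; [exact: selfadj0|move=> x; rewrite ripE]. Qed.

Lemma psd_sum I (r : seq I) (p : pred I) (F : I -> H -> H) :
  (forall i, psd (F i)) -> psd (\sum_(i <- r | p i) F i).
Proof.
by move=> sF; apply: (big_ind (@psd)); [exact: psd0|exact: psd_add|].
Qed.

Lemma psd_amgm B x y t : psd B -> 0 < t ->
  2 * rip (B x) y <= t * rip (B x) x + t^-1 * rip (B y) y.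
Proof.
move=> [[lB _ sB] pB] t0; have := pB (t%:C *: x - y).
rewrite !(linE lB) !ripE [rip (B y) x]sB (ripC y) => h.
have tn : t != 0 by rewrite gt_eqF.
rewrite -(ler_pM2l t0).
have -> : t * (t * rip (B x) x + t^-1 * rip (B y) y) =
          t * (t * rip (B x) x) + rip (B y) y by field.
nra.
Qed.

Lemma psd_cs B x y : psd B -> rip (B x) y ^+ 2 <= rip (B x) x * rip (B y) y.
Proof.
move=> [[lB _ sB] pB].
have h s t : 0 <= s ^+ 2 * rip (B x) x + 2 * s * t * rip (B x) y +
    t ^+ 2 * rip (B y) y.
  have := pB (s%:C *: x + t%:C *: y).
  by rewrite !(linE lB) !ripE [rip (B y) x]sB (ripC y); lra.
have := pB x; have := pB y; move: h.
move: (rip (B x) x) (rip (B x) y) (rip (B y) y) => a b c h c0 a0.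
have [c1|c1] := eqVneq c 0; last first.
  have cp : 0 < c by rewrite lt_def c1.
  have := h c (- b) => h1.
  rewrite -(ler_pM2l cp); nra.
(* With [c = 0] the quadratic form takes here the value [- b ^+ 2 * (a + 2)], so [b = 0]. *)
have := h b (- (a + 1)); rewrite c1; nra.
Qed.

(** Since [M] bounds the squared norm, the sharp constant would be the square root of [M]; AM-GM
    with weight 1 gives [(M + 1) / 2] instead, which recurs in all later bounds. *)
Lemma selfadj_form_le A M x : 0 <= M ->
  (forall x, rip (A x) (A x) <= M * rip x x) ->
  rip (A x) x <= (M + 1) / 2 * rip x x.
Proof.
by move=> M0 hM; have := rip_amgm (A x) x ltr01; rewrite invr1; have := hM x; lra.
Qed.

(** Cauchy-Schwarz for the form of [B] at [x] and [B x], then cancellation of [rip (B x) (B x)]. *)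
Lemma psd_norm_le B M x : psd B ->
  (forall x, rip (B x) x <= M * rip x x) ->
  rip (B x) (B x) <= M * rip (B x) x.
Proof.
move=> pB hM; have := psd_cs x (B x) pB.
have := hM (B x); have := pB.2 x; have := rip_ge0 (B x).
rewrite le_eqVlt => /orP[/eqP <-|q0 p0 h1 h2]; last first.
  by rewrite -(ler_pM2r q0); rewrite expr2 in h2; nra.
move=> h _ _; have [M0|M0] := leP 0 M; first by rewrite mulr_ge0.
have := hM x; have := rip_ge0 x; nra.
Qed.

(* The top of the spectrum of [A - P] is at most 0: on approximate eigenvectors
   for a value m > 0, [A x] is close to [P x + m x], which is too long. *)
Lemma loewner A P : selfadj A -> psd P ->
  (forall x, rip (A x) (A x) = rip (P x) (P x)) -> psd (P - A).
Proof.
move=> sA pP eAP; have sP := pP.1; split; first exact: selfadj_sub.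
have sD : selfadj (A - P) by exact: selfadj_sub.
have [_ [M M0 hM] _] := sD.
have [lP [N N0 hN] aP] := sP; have [lA _ aA] := sA.
pose U := [set c | 0 <= c /\ forall x, rip ((A - P) x) x <= c * rip x x].
have Un : U ((M + 1) / 2).
  by split; [lra|move=> x; exact: selfadj_form_le].
have Ui : has_inf U.
  by split; [exists ((M + 1) / 2)|exists 0 => c []].
pose m := inf U.
have m0 : 0 <= m by apply: lb_le_inf; [exists ((M + 1) / 2)|move=> c []].
have hm x : rip ((A - P) x) x <= m * rip x x.
  apply/ler_addgt0Pr => e e0.
  have := rip_ge0 x; rewrite le_eqVlt => /orP[/eqP/esym q0|q0].
    by have := Un.2 x; rewrite !q0; lra.
  have [c Uc hc] := inf_adherent (divr_gt0 e0 q0) Ui.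
  apply: (le_trans (Uc.2 x)); rewrite -/m in hc.
  have -> : m * rip x x + e = (m + e / rip x x) * rip x x.
    by field; rewrite gt_eqF.
  by rewrite ler_wpM2r ?ltW.
suff m_eq0 : m = 0.
  by move=> x; have := hm x; rewrite m_eq0 !addrfctE !opprfctE !ripE; lra.
apply/eqP; apply: contrapT => /negP mn0.
have mp : 0 < m by rewrite lt_def mn0.
(* [T = m - (A - P)] is positive, so [rip (T x) x] controls the norm of [T x]: a near maximizer of
   the form of [A - P] is an approximate eigenvector. *)
have [T [pT TE]] : exists T, psd T /\ forall x, T x = m%:C *: x - (A x - P x).
  exists ((fun x => m%:C *: x) - (A - P)); split=> //.
  split; first by apply: selfadj_sub => //; exact/selfadj_scale/selfadj_id.
  by move=> x; have := hm x; rewrite !addrfctE !opprfctE !ripE; lra.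
have [lT [K0 K00 hK0] aT] := pT.1.
pose K := (K0 + 1) / 2.
have hK x : rip (T x) (T x) <= K * rip (T x) x.
  by apply: psd_norm_le => // y; exact: selfadj_form_le.
(* Inserting [A x = P x + m x - T x] into the equality of norms bounds [m ^+ 2 * rip x x] by [2 *
   rip (P x) (T x) + 2 * m * rip (T x) x]. AM-GM with weight [h] makes the [P x] part at most a
   quarter of it, and [d] does the same for the [T x] parts, collected in [L]. *)
pose h := m ^+ 2 / (4 * (N + 1)).
have hp : 0 < h by rewrite divr_gt0 ?exprn_gt0//; lra.
have hN4 : h * N <= m ^+ 2 / 4.
  have -> : h * N = m ^+ 2 / 4 * (N / (N + 1)) by rewrite /h; field; lra.
  rewrite ler_piMr ?divr_ge0 ?sqr_ge0//.
  by rewrite ler_pdivrMr; lra.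
pose L := h^-1 * K + 2 * m.
have K1 : 0 <= K by rewrite /K; lra.
have Lp : 0 < L by rewrite /L ltr_wpDl ?mulr_ge0 ?invr_ge0 ?ltW//; lra.
pose d := Num.min m (m ^+ 2 / (4 * L)).
have dp : 0 < d by rewrite lt_min mp divr_gt0 ?exprn_gt0//; lra.
have dm : d <= m by rewrite ge_min lexx.
have dL : L * d <= m ^+ 2 / 4.
  have -> : m ^+ 2 / 4 = L * (m ^+ 2 / (4 * L)) by field; lra.
  by rewrite ler_pM2l// ge_min lexx orbT.
have : ~ U (m - d).
  by move=> Ud; have := ge_inf Ui.2 Ud; rewrite -/m; lra.
apply; split; first by lra.
move=> x; rewrite leNgt; apply/negP => gx.
have q0 : 0 < rip x x.
  rewrite lt_def rip_ge0 andbT; apply/eqP => /[dup] /rip_eq0 x0 q0.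
  by move: gx; rewrite q0 x0 !addrfctE !opprfctE !(linE lA) !(linE lP) !ripE; lra.
have dT : rip (T x) x <= d * rip x x.
  by rewrite TE; move: gx; rewrite !addrfctE !opprfctE !ripE; lra.
have tT := pT.2 x.
have Ax : A x = P x + m%:C *: x - T x.
  rewrite TE; move: (A x) (P x) (m%:C *: x) => u v w.
  by rewrite opprD opprK addrA addrK addrC subrK.
have := eAP x; rewrite Ax !ripE (ripC x (P x)) (ripC (T x) (P x)) (ripC x (T x)).
have pPx := pP.2 x; have qT := rip_ge0 (T x).
have am := rip_amgm (P x) (T x) hp.
have hNx := hN x; have hKx := hK x.
have h1 : h * rip (P x) (P x) <= m ^+ 2 / 4 * rip x x.
  rewrite (le_trans (ler_wpM2l (ltW hp) hNx))// mulrA ler_wpM2r//.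
  exact: ltW.
have h2 : h^-1 * rip (T x) (T x) <= h^-1 * K * (d * rip x x).
  rewrite -mulrA ler_wpM2l ?invr_ge0 ?(ltW hp)//.
  by rewrite (le_trans hKx)// ler_wpM2l.
have h3 : 2 * m * rip (T x) x <= 2 * m * (d * rip x x).
  by rewrite ler_wpM2l//; lra.
have h4 : L * d * rip x x <= m ^+ 2 / 4 * rip x x.
  by rewrite ler_wpM2r// ltW.
have h5 : L * d * rip x x = h^-1 * K * (d * rip x x) + 2 * m * (d * rip x x).
  by rewrite /L; ring.
have h6 : 0 < m ^+ 2 * rip x x by rewrite mulr_gt0// exprn_gt0.
have h7 : 0 <= m * rip (P x) x by rewrite mulr_ge0.
lra.
Qed.

End Selfadjoint.

(** * Riesz representation and Parseval's identity *)

Section Completeness.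
Variables (R : realType) (H : hilbertType R).
Implicit Types (x y z : H) (a : R) (A B P : H -> H).

Lemma norm_lt_rip x (r : R) : 0 <= r -> (`|x| < r%:C) = (rip x x < r ^+ 2).
Proof.
move=> r0; rewrite -(@ltr_pXn2r _ 2) ?nnegrE ?normr_ge0 ?ler0c//.
by rewrite norm2E -rmorphXn ltcR.
Qed.

Lemma complete_rip (u : nat -> H) :
  (forall e : R, 0 < e -> exists N, forall n, (N <= n)%N ->
     rip (u N - u n) (u N - u n) <= e) ->
  exists z, forall e : R, 0 < e -> exists N, forall n, (N <= n)%N ->
     rip (z - u n) (z - u n) <= e.
Proof.
move=> cu; have : cvg (u @ \oo).
  apply: cauchy_cvg; apply: cauchy_exP => -[e e'].
  rewrite ltcE /= => /andP[/eqP-> e0].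
  have [N hN] := cu ((e / 2) ^+ 2) (exprn_gt0 _ (divr_gt0 e0 (ltr0Sn _ 1))).
  exists (u N); near=> n; rewrite -ball_normE /ball_ /=.
  rewrite norm_lt_rip ?ltW// (le_lt_trans (hN _ _))//; last by nra.
  by near: n; exact: nbhs_infty_ge.
move=> /cvg_ex[z uz]; exists z => e e0.
have s0 : 0 < Num.sqrt e by rewrite sqrtr_gt0.
have : 0 < (Num.sqrt e)%:C by rewrite ltcR.
move: uz => /cvgrPdist_lt /[apply] -[N _ hN]; exists N => n Nn.
have := hN n Nn; rewrite /= norm_lt_rip ?(ltW s0)// sqr_sqrtr ?(ltW e0)//.
by move/ltW.
Unshelve. all: by end_near. Qed.

(* [z] is the limit of a minimizing sequence of [|v|^2 - 2 phi v] over [V]. *)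
Lemma closest_form (V : set H) (phi : H -> R) (k : R) :
  V 0 -> (forall x y, V x -> V y -> V (x + y)) ->
  (forall a x, V x -> V (a%:C *: x)) ->
  (forall x y, phi (x + y) = phi x + phi y) ->
  (forall a x, phi (a%:C *: x) = a * phi x) ->
  (forall x, 2 * phi x <= k + rip x x) ->
  exists z, (forall e, 0 < e -> exists2 v, V v & rip (z - v) (z - v) <= e) /\
    forall w, V w -> rip z w = phi w.
Proof.
move=> V0 VD VZ phiD phiZ hk.
pose f x := rip x x - 2 * phi x.
have fL : has_inf (f @` V).
  split; first by exists (f 0), 0.
  by exists (- k) => _ [x _ <-]; rewrite /f; have := hk x; lra.
pose d := inf (f @` V).
have fd v : V v -> d <= f v by move=> Vv; apply: ge_inf; [exact: fL.2|exists v].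
have [u hu] : {u : nat -> H & forall n, V (u n) /\ f (u n) < d + n.+1%:R^-1}.
  apply: (@choice _ _ (fun n v => V v /\ f v < d + n.+1%:R^-1)) => n.
  have n0 : 0 < n.+1%:R^-1 :> R by rewrite invr_gt0.
  by have [_ [v Vv <-] h] := inf_adherent n0 fL; exists v.
have inv_le (e : R) : 0 < e -> exists N, forall n, (N <= n)%N -> n.+1%:R^-1 <= e.
  move=> e0; have [N _ hN] := near_infty_natSinv_lt (PosNum e0).
  by exists N => n Nn; apply: ltW; exact: hN.
(* Parallelogram law: [f] at the midpoint of [u m] and [u n] is at least [d]. *)
have dist m n : rip (u m - u n) (u m - u n) <= 2 * (m.+1%:R^-1 + n.+1%:R^-1).
  have [[Vm hm] [Vn hn]] := (hu m, hu n).
  have := fd _ (VZ (2^-1) _ (VD _ _ Vm Vn)).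
  move: hm hn; rewrite /f phiZ phiD !ripE (ripC (u n) (u m)).
  move: (m.+1%:R^-1) (n.+1%:R^-1) => i j; lra.
have [z hz] : exists z, forall e : R, 0 < e -> exists N, forall n, (N <= n)%N ->
    rip (z - u n) (z - u n) <= e.
  apply: complete_rip => e e0; have [N hN] := inv_le _ (divr_gt0 e0 (ltr0Sn _ 3)).
  exists N => n Nn; apply: (le_trans (dist _ _)).
  have := hN n Nn; have := hN N (leqnn _).
  by move: (N.+1%:R^-1) (n.+1%:R^-1) => i j; lra.
exists z; split.
  move=> e e0; have [N hN] := hz e e0; exists (u N); first exact: (hu N).1.
  exact: hN.
move=> w Vw.
pose c := rip z w - phi w.
(* Near-minimality of [u n] against [u n + t w]; replacing [u n] by its limit [z] costs a second
   [t ^+ 2 * rip w w] by AM-GM. *)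
have key t : 0 <= 2 * t ^+ 2 * rip w w + 2 * t * c.
  apply/ler_addgt0Pr => e e0.
  have e2 : 0 < e / 2 by lra.
  have [N1 hN1] := hz _ e2; have [N2 hN2] := inv_le _ e2.
  pose n := maxn N1 N2.
  have := hN1 n (leq_maxl _ _); have := hN2 n (leq_maxr _ _).
  have [Vn hn] := hu n => h1 h2.
  have := fd _ (VD _ _ Vn (VZ t _ Vw)).
  have am := rip_ge0 (t%:C *: w + (z - u n)).
  move: hn am h2 h1; rewrite /f !phiD !phiZ !ripE /c.
  rewrite (ripC w (u n)) (ripC (u n) z) (ripC w z).
  move: (n.+1%:R^-1) => j; lra.
suff c0 : c = 0 by rewrite /c in c0; lra.
have [w0|w0] := eqVneq (rip w w) 0.
  by have := key c; have := key (- c); rewrite w0; nra.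
have wp : 0 < rip w w by rewrite lt_def w0 rip_ge0.
have := key (- c / (2 * rip w w)).
have -> : 2 * (- c / (2 * rip w w)) ^+ 2 * rip w w + 2 * (- c / (2 * rip w w)) * c
  = - (c ^+ 2 / (2 * rip w w)) by field; lra.
rewrite oppr_ge0 pmulr_lle0 ?invr_gt0; last by lra.
by move=> h; apply/eqP; rewrite -sqrf_eq0 eq_le h sqr_ge0.
Qed.

(** By scaling [x], the last hypothesis amounts to [phi x ^+ 2 <= k * rip x x], that is, to
    boundedness of [phi]; AM-GM delivers it in this form. *)
Lemma riesz (phi : H -> R) (k : R) :
  (forall x y, phi (x + y) = phi x + phi y) ->
  (forall a x, phi (a%:C *: x) = a * phi x) ->
  (forall x, 2 * phi x <= k + rip x x) ->
  exists z, forall w, rip z w = phi w.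
Proof.
move=> phiD phiZ hk.
have [z [_ hz]] := @closest_form setT phi k I (fun _ _ _ _ => I) (fun _ _ _ => I)
   phiD phiZ hk.
by exists z => w; exact: hz.
Qed.

Local Notation T := (onb (H:=H)).
Implicit Types (F G : {fset T}).

Lemma onb_ortho (e f : T) : '[val e, val f] = (e == f)%:R.
Proof.
have [ortho _] := onbP H; rewrite ortho ?(inj_eq val_inj)//; exact: set_valP.
Qed.

Definition proj F x := \sum_(e <- F) '[x, val e] *: val e.

Lemma ortho_eq0 x : (forall e : T, '[x, val e] = 0) -> x = 0.
Proof.
have [_ h] := onbP H => xe; apply: h => e Se.
by have := xe (SigSub (mem_set Se)).
Qed.

Lemma inner_proj F x (e : T) : e \in F -> '[proj F x, val e] = '[x, val e].
Proof.
move=> eF; rewrite /proj linear_sumlz (big_fsetD1 e)//= linearZl_LR /= onb_ortho eqxx.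
rewrite mulr1 big_seq big1 ?addr0// => f.
rewrite !inE => /andP[fe _]; rewrite linearZl_LR /= onb_ortho (negbTE fe).
by rewrite mulr0.
Qed.

Lemma proj_ortho F x (s : seq (R[i] * T)) : (forall p, p \in s -> p.2 \in F) ->
  '[x - proj F x, \sum_(p <- s) p.1 *: val p.2] = 0.
Proof.
move=> sF; rewrite linear_sumr /= big_seq big1// => p /sF pF.
by rewrite linearZr_LR /= linearBl /= inner_proj// subrr mulr0.
Qed.

Lemma proj_seq F x : proj F x = \sum_(p <- [seq ('[x, val e], e) | e <- F]) p.1 *: val p.2.
Proof. by rewrite big_map. Qed.

Lemma proj_min F x (s : seq (R[i] * T)) : (forall p, p \in s -> p.2 \in F) ->
  rip (x - proj F x) (x - proj F x) <=
  rip (x - \sum_(p <- s) p.1 *: val p.2) (x - \sum_(p <- s) p.1 *: val p.2).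
Proof.
move=> sF; have h1 := proj_ortho x sF.
have h2 : '[x - proj F x, proj F x] = 0.
  by rewrite {2}proj_seq proj_ortho// => p /mapP[e eF ->].
move: h1 h2 => /(congr1 (@complex.Re R)) + /(congr1 (@complex.Re R)).
rewrite -![complex.Re '[_, _]]/(rip _ _) /=.
move: (\sum_(p <- s) _) (proj F x) => v p.
have := rip_ge0 (p - v); rewrite !ripE (ripC v x) (ripC p x) (ripC v p); lra.
Qed.

Lemma proj_le F G x : {subset F <= G} ->
  rip (x - proj G x) (x - proj G x) <= rip (x - proj F x) (x - proj F x).
Proof.
by move=> FG; rewrite (proj_seq F) proj_min// => p /mapP[e eF ->]; exact: FG.
Qed.

(** The point [z] closest to [x] in the closed span of the basis differs from [x] by a vector
    orthogonal to every basis element, so maximality of the basis gives [z = x]. *)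
Lemma proj_dense x (e : R) : 0 < e ->
  exists F, rip (x - proj F x) (x - proj F x) <= e.
Proof.
move=> e0; pose V := [set v | exists s : seq (R[i] * T), v = \sum_(p <- s) p.1 *: val p.2].
have [|||||| z [zV hz]] := @closest_form V (rip x) (rip x x).
- by exists [::]; rewrite big_nil.
- by move=> _ _ [s ->] [t ->]; exists (s ++ t); rewrite big_cat.
- move=> a _ [s ->]; exists [seq (a%:C * p.1, p.2) | p <- s].
  by rewrite big_map scaler_sumr; apply: eq_bigr => p _; rewrite scalerA.
- by move=> u v; rewrite ripDr.
- by move=> a v; rewrite ripZr.
- by move=> v; have := rip_ge0 (x - v); rewrite !ripE (ripC v x); lra.
have zx : z = x.
  apply/eqP; rewrite -subr_eq0; apply/eqP; apply: ortho_eq0 => f.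
  have Vc (c : R[i]) : V (c *: val f).
    by exists [:: (c, f)]; rewrite big_seq1.
  rewrite inner_rip !ripDl !ripNl (hz _ (Vc _)) subrr.
  by rewrite -[val f]scale1r (hz _ (Vc _)) subrr.
have [_ [s ->]] := zV e e0; rewrite zx => h.
exists [fset p.2 | p in s]%fset; apply: le_trans h; apply: proj_min => p ps.
by apply/imfsetP; exists p.
Qed.

Lemma rip_proj F x y : rip (proj F x) y =
  \sum_(e <- F) complex.Re ('[x, val e] * '[val e, y]).
Proof.
rewrite /rip /proj linear_sumlz (big_morph _ (@ReD R) (erefl _)).
by apply: eq_bigr => e _; rewrite linearZl_LR.
Qed.

Lemma bessel F x :
  \sum_(e <- F) complex.Re ('[x, val e] * '[val e, x]) <= rip x x.
Proof.
rewrite -rip_proj.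
have h2 : '[x - proj F x, proj F x] = 0.
  by rewrite {2}proj_seq proj_ortho// => p /mapP[e eF ->].
move: h2 => /(congr1 (@complex.Re R)).
rewrite -![complex.Re '[_, _]]/(rip _ _) /=.
have := rip_ge0 (x - proj F x); rewrite !ripE (ripC (proj F x) x); lra.
Qed.

Lemma abs_rip_le x y (e : R) : 0 <= e -> rip x x * rip y y <= e ^+ 2 -> `|rip x y| <= e.
Proof.
move=> e0 h; rewrite -(@ler_pXn2r _ 2) ?nnegrE// real_normK ?num_real//.
apply: le_trans h; apply: (@psd_cs R H id); split; first exact: selfadj_id.
exact: rip_ge0.
Qed.

Lemma near_totally (I : choiceType) (P : {fset I} -> Prop) (F0 : {fset I}) :
  (forall F : {fset I}, {subset F0 <= F} -> P F) -> \forall F \near totally, P F.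
Proof. by move=> h; exists F0 => // F /fsubsetP; exact: h. Qed.

(** The error at [F] is [rip (x - proj F x) y], and the norm of [x - proj F x] can only decrease as
    [F] grows. *)
Lemma parseval x y :
  (fun F : {fset T} => \sum_(e <- F) complex.Re ('[x, val e] * '[val e, y]))
    @ totally --> rip x y.
Proof.
apply/cvgrPdist_le => e e0.
have q0 : 0 < rip y y + 1 by have := rip_ge0 y; lra.
have [F0 hF0] := @proj_dense x (e ^+ 2 / (rip y y + 1)) (divr_gt0 (exprn_gt0 2 e0) q0).
apply: (near_totally (F0 := F0)) => F F0F.
rewrite -rip_proj -ripNl -ripDl; apply: abs_rip_le; first exact: ltW.
have := le_trans (proj_le _ F0F) hF0; rewrite ler_pdivlMr//.
by apply: le_trans; rewrite ler_wpM2l ?rip_ge0//; lra.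
Qed.

End Completeness.

(** * Traces of operators *)

Section TraceSums.
Variables (R : realType) (H : hilbertType R).
Implicit Types (x y z u v : H) (a : R) (A B P : H -> H).
Local Notation T := (onb (H:=H)).
Implicit Types (F G : {fset T}) (e : T).

(* Only real parts are followed; the imaginary part of [Tr A] is minus the real
   trace of [fun x => 'i *: A x], see [ReTr]. *)
Definition ptr A F : R := \sum_(e <- F) rip (A (val e)) (val e).

(** A relation carries convergence along with the value, whereas [Tr] is a limit operator that
    returns a value even for a divergent net. *)
Definition rtr A (l : R) := ptr A @ totally --> l.

Lemma rtr_uniq A l l' : rtr A l -> rtr A l' -> l = l'.
Proof. by move=> /cvg_lim h1 /cvg_lim h2; rewrite -h1// -h2. Qed.

Lemma rtr_ext A B l : rtr A l -> (forall x, A x = B x) -> rtr B l.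
Proof. by move=> + /funext <-. Qed.

Lemma rtr_add A B l l' : rtr A l -> rtr B l' -> rtr (A + B) (l + l').
Proof.
move=> hA hB; rewrite /rtr (_ : ptr (A + B) = ptr A + ptr B); first exact: cvgD.
apply: funext => F.
by rewrite -[RHS]/(ptr A F + ptr B F) /ptr -big_split; apply: eq_bigr => e _; rewrite addrfctE ripDl.
Qed.

Lemma rtr_scale A l a : rtr A l -> rtr (fun x => a%:C *: A x) (a * l).
Proof.
move=> hA; rewrite /rtr (_ : ptr _ = fun F => a * ptr A F); first exact: cvgMr.
apply: funext => F.
by rewrite /ptr mulr_sumr; apply: eq_bigr => e _; rewrite ripZl.
Qed.

Lemma rtr_opp A l : rtr A l -> rtr (- A) (- l).
Proof.
move=> /(rtr_scale (a := -1)); rewrite mulN1r => h; apply: (rtr_ext h) => x.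
by rewrite rmorphN1 scaleN1r.
Qed.

Lemma rtr_sub A B l l' : rtr A l -> rtr B l' -> rtr (A - B) (l - l').
Proof. by move=> hA hB; apply: rtr_add => //; exact: rtr_opp. Qed.

Lemma rtr0 : rtr 0 0.
Proof.
rewrite /rtr (_ : ptr 0 = cst 0); first exact: cvg_cst.
by apply: funext => F; rewrite /ptr big1// => e _; rewrite rip0l.
Qed.

Lemma rtr_sum I (r : seq I) (A : I -> H -> H) (l : I -> R) :
  (forall i, rtr (A i) (l i)) -> rtr (\sum_(i <- r) A i) (\sum_(i <- r) l i).
Proof.
move=> h; elim: r => [|i r IH]; first by rewrite !big_nil; exact: rtr0.
by rewrite !big_cons; exact: rtr_add.
Qed.

Lemma rtr_le A l t : rtr A l -> (forall F, ptr A F <= t) -> l <= t.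
Proof.
move=> hA hF; have <- := cvg_lim (@Rhausdorff R) hA.
apply: limr_le; first by apply/cvg_ex; exists l.
exact: nearW.
Qed.

Lemma rtr_abs_le A l t : rtr A l -> (forall F, `|ptr A F| <= t) -> `|l| <= t.
Proof.
move=> hA hF; rewrite ler_norml lerNl; apply/andP; split.
  apply: (rtr_le (rtr_opp hA)) => F; rewrite (_ : ptr (- A) F = - ptr A F).
    by have := hF F; rewrite ler_norml => /andP[]; lra.
  by rewrite /ptr -sumrN; apply: eq_bigr => e _; rewrite opprfctE ripNl.
by apply: (rtr_le hA) => F; have := hF F; rewrite ler_norml => /andP[].
Qed.

Definition rank1 u v : H -> H := fun x => '[x, v] *: u.

(** Here traces become independent of the basis: the diagonal sum is Parseval's series for [A u] and
    [v]. *)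
Lemma rtr_rank1 A u v : linear A -> rtr (A \o rank1 u v) (rip (A u) v).
Proof.
move=> lA; rewrite /rtr (_ : ptr _ = fun F =>
  \sum_(e <- F) complex.Re ('[A u, val e] * '[val e, v])); first exact: parseval.
apply: funext => F; apply: eq_bigr => e _.
by rewrite /rip /rank1 /= (linZ lA) linearZl_LR /= mulrC.
Qed.

Lemma partial_sumE (f : T -> R[i]) F : partial_sum f F = \sum_(e <- F) f e.
Proof. by rewrite /partial_sum big_seq_fsetE. Qed.

(** [Tr] is a single limit in [R[i]], so its real part can be identified only once the imaginary
    parts converge as well; the second hypothesis says that they do. *)
Lemma ReTr A l l' : rtr A l -> rtr (fun x => 'i *: A x) l' -> complex.Re (Tr A) = l.
Proof.
move=> hl hl'; suff -> : Tr A = l -i* l' by [].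
apply: (@cvg_lim R[i]^o) => //.
apply/cvgrPdist_le => -[e e']; rewrite ltcE /= => /andP[/eqP-> e0].
have e20 : 0 < e / 2 by lra.
move/cvgrPdist_le : hl => /(_ _ e20) h1; move/cvgrPdist_le : hl' => /(_ _ e20) h2.
near=> F.
have n1 : `|l - ptr A F| <= e / 2 by near: F.
have n2 : `|l' - ptr (fun x => 'i *: A x) F| <= e / 2 by near: F.
rewrite partial_sumE.
have -> : \sum_(e <- F) '[A (val e), val e] =
   ptr A F -i* ptr (fun x => 'i *: A x) F.
  apply/eqP; rewrite eq_complex /=; apply/andP; split; apply/eqP.
    by rewrite (big_morph _ (@ReD R) (erefl _)).
  rewrite (_ : complex.Im _ = complex.Re (- 'i * \sum_(e <- F) '[A (val e), val e])).
    rewrite mulr_sumr (big_morph _ (@ReD R) (erefl _)) -sumrN.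
    apply: eq_bigr => f _; rewrite ripiC opprK /rip linearZr_LR /=.
    by case: '[_, _] => p q /=; ring.
  by case: (\sum_(e <- F) _) => p q /=; ring.
rewrite normc_def lecR /=.
rewrite -[leRHS]ger0_norm ?(ltW e0)// -sqrtr_sqr ler_wsqrtr//.
move: n1 n2; rewrite !ler_norml => /andP[p1 p2] /andP[p3 p4].
move: (ptr A F) (ptr _ F) p1 p2 p3 p4 => s s' p1 p2 p3 p4.
rewrite opprK; nra.
Unshelve. all: by end_near. Qed.

End TraceSums.

(** * Finite rank approximation of positive trace class operators *)

Section Cholesky.
Variables (R : realType) (H : hilbertType R).
Implicit Types (x y z u v : H) (a : R) (A B P : H -> H).
Local Notation T := (onb (H:=H)).
Implicit Types (F G : {fset T}) (e : T).

Lemma psd_eq0 B x : psd B -> rip (B x) x = 0 -> B x = 0.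
Proof.
move=> pB h; apply: rip_eq0; have := psd_cs x (B x) pB.
rewrite h mul0r => h2; apply/eqP; rewrite -sqrf_eq0 eq_le h2 sqr_ge0.
by [].
Qed.

Lemma inner_adj A A' : linear A' -> (forall x y, rip (A x) y = rip x (A' y)) ->
  forall x y, '[A x, y] = '[x, A' y].
Proof. by move=> lA' h x y; rewrite !inner_rip !h (linZ lA'). Qed.

Lemma inner_selfadj A x : selfadj A -> '[A x, x] = (rip (A x) x)%:C.
Proof.
move=> [lA _ aA]; have := innerC (A x) x; rewrite -(inner_adj lA aA) /rip.
by case: '[A x, x] => p q [] h; congr Complex; lra.
Qed.

Lemma inner_scaler (a : R) x y : '[x, a%:C *: y] = a%:C * '[x, y].
Proof.
rewrite innerC linearZl_LR /= [in RHS]innerC.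
by case: '[y, x] => p q; apply/eqP; rewrite eq_complex /=; apply/andP; split;
  apply/eqP; ring.
Qed.

Lemma rip_inner_scale x y : rip x ('[x, y] *: y) =
  complex.Re '[x, y] ^+ 2 + complex.Im '[x, y] ^+ 2.
Proof.
by rewrite /rip linearZr_LR /=; case: '[x, y] => p q /=; ring.
Qed.

Lemma rip_cscale (c : R[i]) x : rip (c *: x) (c *: x) =
  (complex.Re c ^+ 2 + complex.Im c ^+ 2) * rip x x.
Proof.
rewrite {1}/rip linearZl_LR /= linearZr_LR /= innerxx.
by case: c => p q /=; ring.
Qed.

Lemma inner_cs x y :
  complex.Re '[x, y] ^+ 2 + complex.Im '[x, y] ^+ 2 <= rip x x * rip y y.
Proof.
have := @psd_cs R H id x ('[x, y] *: y) (conj (selfadj_id H) (@rip_ge0 R H)).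
rewrite rip_inner_scale rip_cscale.
set w := _ + _; have w0 : 0 <= w by rewrite addr_ge0 ?sqr_ge0.
move=> h; have [w1|w1] := eqVneq w 0.
  by rewrite w1 mulr_ge0 ?rip_ge0.
have wp : 0 < w by rewrite lt_def w1.
by rewrite -(ler_pM2l wp); nra.
Qed.

Lemma selfadj_rank1 u : selfadj (rank1 u u).
Proof.
split.
- by move=> c x y; rewrite /rank1 linearPl /= scalerDl scalerA.
- exists (rip u u * rip u u); first by rewrite mulr_ge0 ?rip_ge0.
  move=> x; rewrite rip_cscale mulrAC ler_wpM2r ?rip_ge0// mulrC.
  exact: inner_cs.
- move=> x y; rewrite /rank1 /rip linearZl_LR linearZr_LR /= [in RHS]innerC.
  by case: '[x, u] => ? ?; case: '[u, y] => ? ? /=; ring.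
Qed.

Lemma psd_rank1 u : psd (rank1 u u).
Proof.
split=> [|x]; first exact: selfadj_rank1.
by rewrite ripC rip_inner_scale addr_ge0 ?sqr_ge0.
Qed.

(* At [rip (B x) x = 0] the junk value [0^-1 = 0] makes this [B] itself. *)
Definition deflate B x : H -> H :=
  B - (fun y => ((rip (B x) x)^-1)%:C *: rank1 (B x) (B x) y).

Lemma deflate_comp B x y : psd B ->
  deflate B x y = B (y - ('[y, B x] * ((rip (B x) x)^-1)%:C) *: x).
Proof.
move=> [[lB _ _] _]; rewrite !(linD lB) !(linN lB) (linZ lB).
by rewrite /deflate addrfctE opprfctE /rank1 scalerA mulrC.
Qed.

(** Completing the square: the deflated form at [y] is the form of [B] at [y - w *: x], the
    component of [y] that is orthogonal to [x] for the form of [B]. *)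
Lemma psd_deflate B x : psd B -> psd (deflate B x).
Proof.
move=> pB; have [sB hB] := pB; have [lB _ aB] := sB; split.
  by apply: selfadj_sub => //; exact/selfadj_scale/selfadj_rank1.
move=> y; have [c0|c0] := eqVneq (rip (B x) x) 0.
  by rewrite /deflate c0 invr0 addrfctE opprfctE scale0r subr0.
pose w := '[y, B x] * ((rip (B x) x)^-1)%:C.
have hw : rip (B (y - w *: x)) (w *: x) = 0.
  rewrite /rip linearZr_LR /= (linD lB) (linN lB) (linZ lB).
  rewrite linearBl linearZl_LR /= (inner_adj lB aB y x) (inner_selfadj _ sB).
  by rewrite /w -mulrA -rmorphM mulVf// mulr1 subrr mulr0.
have := hB (y - w *: x).
by rewrite [rip _ (y - _)]ripDr ripNr hw subr0 -deflate_comp.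
Qed.

Lemma deflate_eq B x y : psd B -> B y = 0 -> deflate B x y = 0.
Proof.
move=> [[lB _ aB] _] h; rewrite /deflate addrfctE opprfctE /rank1 h.
by rewrite -(inner_adj lB aB) h linear0l scale0r scaler0 subr0.
Qed.

Lemma deflate_self B x : psd B -> deflate B x x = 0.
Proof.
move=> pB; have [sB _] := pB; have [lB _ aB] := sB.
rewrite /deflate addrfctE opprfctE /rank1 -(inner_adj lB aB) inner_selfadj//.
rewrite scalerA -rmorphM; have [c0|c0] := eqVneq (rip (B x) x) 0.
  by rewrite (psd_eq0 pB c0) scaler0 subr0.
by rewrite mulVf// scale1r subrr.
Qed.

Lemma deflateE B x : psd B -> exists u, B = rank1 u u + deflate B x.
Proof.
move=> pB; exists ((Num.sqrt (rip (B x) x)^-1)%:C *: B x).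
apply: funext => y; rewrite addrfctE /deflate addrfctE opprfctE.
rewrite /rank1 inner_scaler addrCA scalerA mulrAC -rmorphM -expr2.
by rewrite sqr_sqrtr ?invr_ge0 ?pB.2// -scalerA subrr addr0.
Qed.

(** A deflation keeps the zeros produced by earlier ones, so the remainder ends up vanishing on all
    of [s]. *)
Lemma cholesky B (s : seq T) : psd B ->
  exists g : seq H, exists B', [/\ psd B', forall e, e \in s -> B' (val e) = 0 &
    B = \sum_(u <- g) rank1 u u + B'].
Proof.
move=> pB; elim: s => [|e s [g [B' [pB' zB' EB]]]].
  by exists [::], B; split => //; rewrite big_nil add0r.
have [u Eu] := deflateE (val e) pB'.
exists (rcons g u), (deflate B' (val e)); split; first exact: psd_deflate.
- move=> f; rewrite inE => /predU1P[->|fs]; first exact: deflate_self.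
  by apply: deflate_eq => //; exact: zB'.
- by rewrite -cats1 big_cat /= big_seq1 -addrA -Eu.
Qed.

(** For positive [B]: trace class with trace at most [t], expressed without a limit. *)
Definition tr_le B t := forall F, ptr B F <= t.

Lemma ptr_add A B F : ptr (A + B) F = ptr A F + ptr B F.
Proof.
by rewrite /ptr -big_split; apply: eq_bigr => e _; rewrite addrfctE ripDl.
Qed.

Lemma ptr_ge0 B F : psd B -> 0 <= ptr B F.
Proof. by move=> [_ pB]; apply: sumr_ge0. Qed.

Lemma psd_ksum (g : seq H) : psd (\sum_(u <- g) rank1 u u).
Proof. by apply: psd_sum => u; exact: psd_rank1. Qed.

Lemma tr_le_rank1 B t (g : seq H) B' : psd B' -> tr_le B t ->
  B = \sum_(u <- g) rank1 u u + B' -> \sum_(u <- g) rip u u <= t.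
Proof.
move=> pB' tB EB.
have h : rtr (\sum_(u <- g) rank1 u u) (\sum_(u <- g) rip u u).
  apply: rtr_sum => u; have := @rtr_rank1 R H id u u; apply.
  by move=> c x y.
apply: (rtr_le h) => F; apply: le_trans (tB F).
by rewrite EB ptr_add lerDl ptr_ge0.
Qed.

(** Take [F0] whose partial trace is within [eps] of the supremum and deflate on [F0]: the remainder
    has no diagonal on [F0], and off [F0] its diagonal is below that of [B], which sums to less than
    [eps]. *)
Lemma low_rank B t eps : psd B -> tr_le B t -> 0 < eps ->
  exists g : seq H, exists B', [/\ psd B', tr_le B' eps &
    B = \sum_(u <- g) rank1 u u + B'].
Proof.
move=> pB tB eps0.
have hs : has_sup (range (ptr B)).
  by split; [exists (ptr B fset0), fset0|exists t => _ [F _ <-]].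
have [_ [F0 _ <-] hF0] := sup_adherent eps0 hs.
have [g [B' [pB' zB' EB]]] := cholesky (enum_fset F0) pB.
exists g, B'; split => // F.
have -> : ptr B' F = ptr B' (F `\` F0)%fset.
  apply/esym/big_fset_incl; first exact: fsubsetDl.
  move=> e eF; rewrite !inE eF andbT negbK => /zB' ->.
  exact: rip0l.
apply: (@le_trans _ _ (ptr B (F `\` F0)%fset)).
  by rewrite EB ptr_add lerDr ptr_ge0//; exact: psd_ksum.
have : ptr B (F0 `|` F)%fset <= sup (range (ptr B)).
  by apply: sup_upper_bound => //; exists (F0 `|` F)%fset.
have -> : ptr B (F0 `|` F)%fset = ptr B F0 + ptr B (F `\` F0)%fset.
  rewrite /ptr (big_fsetID _ (mem F0)) /=; congr (_ + _); congr (\sum_(e <- enum_fset _) _);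
    by apply/fsetP => e; rewrite !inE /=; case: (e \in F0); rewrite ?andbT ?andbF.
lra.
Qed.

End Cholesky.

(** * Traces of products with a positive trace class operator *)

Section TraceBounds.
Variables (R : realType) (H : hilbertType R).
Implicit Types (x y z u v : H) (a M t eps : R) (A B P : H -> H).
Local Notation T := (onb (H:=H)).
Implicit Types (F G : {fset T}) (e : T).

Lemma rip_onb e : rip (val e) (val e) = 1.
Proof. by rewrite /rip onb_ortho eqxx. Qed.

Lemma rank1_form (g : seq H) x :
  rip ((\sum_(u <- g) rank1 u u) x) x =
  \sum_(u <- g) complex.Re ('[x, u] * '[u, x]).
Proof.
rewrite fct_sumE /rip linear_sumlz (big_morph _ (@ReD R) (erefl _)).
by apply: eq_bigr => u _; rewrite /rank1 linearZl_LR.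
Qed.

(** The operator norm is at most the trace. After deflation on an [F] that nearly captures [x], the
    rank one part obeys the bound by Cauchy-Schwarz, and the remainder only sees the small vector
    [x - proj F x]. *)
Lemma psd_le_tr B t x : psd B -> tr_le B t -> rip (B x) x <= t * rip x x.
Proof.
move=> pB tB; have [[lB [M M0 hM] aB] _] := pB.
apply/ler_addgt0Pr => eps eps0.
have [F hF] := @proj_dense R H x (eps / ((M + 1) / 2)) ltac:(apply: divr_gt0; lra).
have [g [B' [pB' zB' EB]]] := cholesky (enum_fset F) pB.
rewrite EB addrfctE ripDl lerD//.
  rewrite rank1_form (@le_trans _ _ (\sum_(u <- g) rip u u * rip x x))//.
    apply: ler_sum => u _; rewrite [leRHS]mulrC (le_trans _ (inner_cs x u))//.
    by rewrite (innerC u x); case: '[x, u] => p q /=; lra.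
  by rewrite -mulr_suml ler_wpM2r ?rip_ge0//; exact: (tr_le_rank1 pB' tB EB).
have [[lB' _ aB'] _] := pB'.
have zp : B' (proj F x) = 0.
  rewrite /proj (lin_sum lB') big_seq big1// => e eF.
  by rewrite (linZ lB') zB'// scaler0.
have e1 : B' x = B' (x - proj F x) by rewrite (linD lB') (linN lB') zp subr0.
have -> : rip (B' x) x = rip (B' (x - proj F x)) (x - proj F x).
  by rewrite ripDr ripNr (aB' _ (proj F x)) zp rip0r subr0 -e1.
set r := x - _ in hF *.
have : rip (B' r) r <= rip (B r) r.
  by rewrite EB addrfctE ripDl lerDr; exact: (psd_ksum g).2.
move=> /le_trans; apply; have := @selfadj_form_le R H B M r M0 hM; move=> /le_trans; apply.
by rewrite mulrC -ler_pdivlMr//; lra.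
Qed.

(** The adjoint is carried as data and [M] bounds both squared norms. Pairs with distinct [A] and
    [A'] occur for ['i *: A], which gives the imaginary parts of traces. *)
Definition adjb A A' M :=
  0 <= M /\ [/\ linear A, linear A', forall x, rip (A x) (A x) <= M * rip x x,
    forall x, rip (A' x) (A' x) <= M * rip x x &
    forall x y, rip (A x) y = rip x (A' y)].

Lemma selfadj_adjb A : selfadj A -> exists M, adjb A A M.
Proof. by move=> [lA [M M0 hM] aA]; exists M. Qed.

Lemma adjb_i A A' M : adjb A A' M ->
  adjb (fun x => 'i *: A x) (fun x => - ('i *: A' x)) M.
Proof.
move=> [M0 [lA lA' hA hA' aA]]; split => //; split.
- exact: linear_scale.
- by apply: linear_opp; exact: linear_scale.
- by move=> x; rewrite rip_cscale /= expr0n /= add0r expr1n mul1r.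
- by move=> x; rewrite ripNl ripNr opprK rip_cscale /= expr0n /= add0r expr1n mul1r.
- by move=> x y; rewrite ripiC aA (linZ lA') ripNr.
Qed.

(** For each rank one part of [B], moving [A] to the other side turns the sum over [F] into a Bessel
    sum for [A' u]. *)
Lemma ptr_conj_le B t A A' M F : psd B -> tr_le B t -> adjb A A' M ->
  \sum_(e <- F) rip (B (A (val e))) (A (val e)) <= M * t.
Proof.
move=> pB tB [M0 [lA lA' hA hA' aA]].
apply/ler_addgt0Pr => eps eps0.
(* The remainder is estimated crudely by [d * M] per vector of [F], so [d] has to depend on
   [size F]. *)
pose d := eps / (M * (size F)%:R + 1).
have n0 : 0 < M * (size F)%:R + 1 by rewrite ltr_wpDl// mulr_ge0.
have d0 : 0 < d by rewrite divr_gt0.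
have [g [B' [pB' tB' EB]]] := low_rank pB tB d0.
rewrite (eq_bigr (fun e : T =>
  \sum_(u <- g) complex.Re ('[A (val e), u] * '[u, A (val e)]) +
  rip (B' (A (val e))) (A (val e)))); last first.
  by move=> e _; rewrite EB addrfctE ripDl rank1_form.
rewrite big_split lerD//=.
  rewrite exchange_big /= (@le_trans _ _ (\sum_(u <- g) M * rip u u))//.
    apply: ler_sum => u _; apply: le_trans (hA' u).
    apply: le_trans (bessel F (A' u)); apply: ler_sum => e _.
    rewrite (inner_adj lA' aA) (innerC (val e)) (innerC u) (inner_adj lA' aA).
    rewrite (innerC (val e)).
    by case: '[A' u, val e] => p q /=; lra.
  by rewrite -mulr_sumr ler_wpM2l//; exact: (tr_le_rank1 pB' tB EB).
apply: (@le_trans _ _ (\sum_(e <- F) d * M)).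
  apply: ler_sum => e _; apply: le_trans (psd_le_tr _ pB' tB') _.
  by rewrite ler_wpM2l ?(ltW d0)// (le_trans (hA _))// rip_onb mulr1.
rewrite big_const_seq count_predT iter_addr_0 -mulr_natr /d.
rewrite -mulrA mulrAC ler_pdivrMr// ler_wpM2l ?(ltW eps0)//; lra.
Qed.

Lemma ptr_comp_le B t A A' M F : psd B -> tr_le B t -> adjb A A' M ->
  \sum_(e <- F) `|rip (B (A (val e))) (val e)| <= (M + 1) / 2 * t.
Proof.
move=> pB tB aA; have h1 := ptr_conj_le F pB tB aA; have := tB F; rewrite /ptr => h2.
apply: (@le_trans _ _ (\sum_(e <- F) (2^-1 * rip (B (A (val e))) (A (val e))
  + 2^-1 * rip (B (val e)) (val e)))); last first.
  by rewrite big_split /= -!mulr_sumr; lra.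
apply: ler_sum => e _; rewrite ler_norml.
have := psd_amgm (A (val e)) (val e) pB ltr01.
have := psd_amgm (A (val e)) (- val e) pB ltr01.
have [[lB _ _] _] := pB.
by rewrite (linN lB) ripNl !ripNr invr1 => p q; apply/andP; split; lra.
Qed.

Lemma ptr_comp_abs_le B t A A' M F : psd B -> tr_le B t -> adjb A A' M ->
  `|ptr (B \o A) F| <= (M + 1) / 2 * t.
Proof.
by move=> pB tB aA; apply: le_trans (ptr_comp_le F pB tB aA); exact: ler_norm_sum.
Qed.

Lemma rtr_rank1_comp A A' M u : adjb A A' M -> rtr (rank1 u u \o A) (rip (A u) u).
Proof.
move=> [M0 [lA lA' hA hA' aA]].
rewrite aA /rtr (_ : ptr _ = fun F =>
  \sum_(e <- F) complex.Re ('[u, val e] * '[val e, A' u])); first exact: parseval.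
apply: funext => F; apply: eq_bigr => e _.
by rewrite /rip /rank1 /= linearZl_LR /= mulrC (inner_adj lA' aA).
Qed.

Lemma rtr_ksum_comp A A' M (g : seq H) : adjb A A' M ->
  rtr ((\sum_(u <- g) rank1 u u) \o A) (\sum_(u <- g) rip (A u) u).
Proof.
move=> aA; have h u : rtr (rank1 u u \o A) (rip (A u) u)
  by exact: rtr_rank1_comp aA.
apply: (rtr_ext (rtr_sum (r := g) h)) => x.
by rewrite /= !fct_sumE.
Qed.

(** The net is Cauchy: its finite rank part converges by Parseval, and the rest is small uniformly
    in [F]. *)
Lemma rtr_ex B t A A' M : psd B -> tr_le B t -> adjb A A' M ->
  exists2 l, rtr (B \o A) l & `|l| <= (M + 1) / 2 * t.
Proof.
move=> pB tB aA; have [M0 _] := aA.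
suff /cvg_ex[l hl] : cvg (ptr (B \o A) @ totally).
  by exists l => //; apply: (rtr_abs_le hl) => F; exact: (ptr_comp_abs_le _ pB tB aA).
apply: cauchy_cvg; apply: cauchy_exP => eps eps0.
have d0 : 0 < eps / (2 * (M + 1)) by rewrite divr_gt0//; lra.
have [g [B' [pB' tB' EB]]] := low_rank pB tB d0.
exists (\sum_(u <- g) rip (A u) u).
have /cvgrPdist_lt/(_ (eps / 2)) := rtr_ksum_comp (g := g) aA.
move=> /(_ ltac:(lra)); apply: filterS => F h.
rewrite -ball_normE /ball_ /=.
have -> : ptr (B \o A) F =
    ptr ((\sum_(u <- g) rank1 u u) \o A) F + ptr (B' \o A) F.
  by rewrite -ptr_add EB; apply: eq_bigr => e _; rewrite /= !addrfctE.
rewrite opprD addrA (le_lt_trans (ler_normB _ _))//.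
have := ptr_comp_abs_le F pB' tB' aA.
have -> : (M + 1) / 2 * (eps / (2 * (M + 1))) = eps / 4 by field; lra.
by move=> ?; lra.
Qed.

(** The list [g] is chosen before [A]; this uniformity is what later lets the primal objective pass
    to weak limits. *)
Lemma low_rank_rtr B t eps : psd B -> tr_le B t -> 0 < eps ->
  exists g : seq H, forall A A' M l, adjb A A' M -> rtr (B \o A) l ->
    `|l - \sum_(u <- g) rip (A u) u| <= (M + 1) / 2 * eps.
Proof.
move=> pB tB eps0; have [g [B' [pB' tB' EB]]] := low_rank pB tB eps0.
exists g => A A' M l aA hl.
have [l' hl' l'le] := rtr_ex pB' tB' aA.
suff -> : l = \sum_(u <- g) rip (A u) u + l' by rewrite addrAC subrr add0r.
apply: rtr_uniq hl _; apply: (rtr_ext (rtr_add (rtr_ksum_comp (g := g) aA) hl')) => x.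
by rewrite EB.
Qed.

Lemma rtr_psd_ge0 B t A l : psd B -> tr_le B t -> psd A -> rtr (B \o A) l -> 0 <= l.
Proof.
move=> pB tB [sA pA] hl; have [M aA] := selfadj_adjb sA; have [M0 _] := aA.
apply/ler_addgt0Pr => eps eps0.
have d0 : 0 < eps / ((M + 1) / 2) by rewrite divr_gt0//; lra.
have [g hg] := low_rank_rtr pB tB d0.
have := hg _ _ _ _ aA hl; have g0 : 0 <= \sum_(u <- g) rip (A u) u by exact: sumr_ge0.
have -> : (M + 1) / 2 * (eps / ((M + 1) / 2)) = eps by field; lra.
by rewrite ler_norml => /andP[]; lra.
Qed.

(* [A] dominates the rank one operator subtracted in [deflate A x], so a zero
   trace forces [rip (B (A x)) (A x) = 0]. *)
Lemma rtr_psd_eq0 B t A : psd B -> tr_le B t -> psd A -> rtr (B \o A) 0 ->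
  forall x, B (A x) = 0.
Proof.
move=> pB tB pA h0 x; have [[lB _ _] _] := pB.
have [c0|c0] := eqVneq (rip (A x) x) 0; first by rewrite (psd_eq0 pA c0) (lin0 lB).
have cp : 0 < rip (A x) x by rewrite lt_def c0 pA.2.
apply: psd_eq0 => //; apply/eqP; rewrite eq_le (pB.2 (A x)) andbT.
have hr := rtr_scale (a := (rip (A x) x)^-1) (rtr_rank1 (u := A x) (v := A x) lB).
have := rtr_sub h0 hr; rewrite sub0r.
move=> h; have : rtr (B \o deflate A x) (- ((rip (A x) x)^-1 * rip (B (A x)) (A x))).
  apply: (rtr_ext h) => y.
  by rewrite /= /deflate !addrfctE !opprfctE (linD lB) (linN lB) (linZ lB).
move/(rtr_psd_ge0 pB tB (psd_deflate x pA)).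
by rewrite oppr_ge0 pmulr_rle0 ?invr_gt0.
Qed.

End TraceBounds.

(** * Trace class operators as differences of positive ones *)

Section TraceClass.
Variables (R : realType) (H : hilbertType R).
Implicit Types (x y z u v : H) (a M t eps : R) (A B C D P N : H -> H).
Local Notation T := (onb (H:=H)).
Implicit Types (F G : {fset T}) (e : T).

Lemma esum_onb (f : H -> \bar R) :
  (\esum_(e in onb (H:=H)) f e = \esum_(e in [set: T]) f (val e))%E.
Proof.
apply: reindex_esum; split.
- by move=> e _; exact: set_valP.
- by move=> e f' _ _; exact: val_inj.
- by move=> x Sx; exists (SigSub (mem_set Sx)).
Qed.

Lemma esum_ptr_le A : psd A ->
  (\esum_(e in onb (H:=H)) (complex.Re '[A e, e])%:E < +oo)%E ->
  exists t, tr_le A t.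
Proof.
move=> [_ pA]; rewrite esum_onb; set s := esum _ _ => s_fin.
have hF F : ((ptr A F)%:E <= s)%E.
  apply: esum_ge; exists [set` F]; first by split; [exact: finite_fset|].
  by rewrite fsbig_finite ?finite_fset//= set_fsetK /ptr -sumEFin.
have s0 : (0 <= s)%E by have := hF fset0; rewrite /ptr big_seq_fset0.
exists (fine s) => F; rewrite -lee_fin fineK//.
by rewrite ge0_fin_numE.
Qed.

Lemma tr_le_esum A t : tr_le A t ->
  (\esum_(e in onb (H:=H)) (complex.Re '[A e, e])%:E < +oo)%E.
Proof.
move=> tA; rewrite esum_onb; apply: (@le_lt_trans _ _ t%:E); last exact: ltry.
apply: ub_ereal_sup => _ [X [finX _] <-].
by rewrite fsbig_finite//= sumEFin lee_fin; exact: tA.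
Qed.

Lemma trace_class_abs A : selfadj A -> trace_class A ->
  exists P t, [/\ psd P, tr_le P t, psd (P - A) & psd (P + A)].
Proof.
move=> sA [_ [P [/psdP pP hP] /(esum_ptr_le pP)[t tP]]].
have [_ _ aP] := pP.1.
have eq x : rip (A x) (A x) = rip (P x) (P x).
  by rewrite -aP /rip hP.
exists P, t; split => //; first exact: loewner.
rewrite -[A]opprK; apply: loewner => //; first exact: selfadj_opp.
by move=> x; rewrite opprfctE ripNl ripNr opprK eq.
Qed.

Lemma psd_trace_class B t : psd B -> tr_le B t -> trace_class B.
Proof.
move=> pB tB; have /psdP[bB hB _] := pB; split => //; exists B; last exact: tr_le_esum tB.
by split; [exact/psdP|move=> x y; rewrite hB].
Qed.

Lemma trace_class_tr_le B : psd B -> trace_class B -> exists t, tr_le B t.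
Proof.
move=> pB /(trace_class_abs pB.1)[P [t [pP tP pPB _]]]; exists t => F.
apply: le_trans (tP F); apply: ler_sum => e _.
by have := pPB.2 (val e); rewrite addrfctE opprfctE ripDl ripNl; lra.
Qed.

Definition tr_diff C := exists P N t,
  [/\ psd P, psd N, tr_le P t, tr_le N t & C = P - N].

(** The splitting is [|C| - (|C| - C)] rather than into positive and negative parts; [- C <= |C|]
    bounds the partial traces of [|C| - C] by [2 t]. *)
Lemma trace_class_diff C : selfadj C -> trace_class C -> tr_diff C.
Proof.
move=> sC /(trace_class_abs sC)[P [t [pP tP pPC pPC']]].
have t0 : 0 <= t by apply: le_trans (ptr_ge0 fset0 pP) (tP _).
exists P, (P - C), (t + t); split => //.
- by move=> F; rewrite (le_trans (tP F))// lerDl.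
- move=> F; rewrite (@le_trans _ _ (ptr (P + P) F))//.
    apply: ler_sum => e _; have := pPC'.2 (val e).
    by rewrite !addrfctE opprfctE !ripDl ripNl; lra.
  by rewrite ptr_add lerD.
- by rewrite opprB addrC subrK.
Qed.

Lemma psd_diff B t : psd B -> tr_le B t -> tr_diff B.
Proof.
move=> pB tB; have t0 : 0 <= t by apply: le_trans (ptr_ge0 fset0 pB) (tB _).
exists B, 0, t; split => //; rewrite ?subr0//; first exact: psd0.
by move=> F; rewrite /ptr big1// => e _; rewrite rip0l.
Qed.

Lemma low_rank_diff C eps : tr_diff C -> 0 < eps ->
  exists g h : seq H, forall A A' M l, adjb A A' M -> rtr (C \o A) l ->
    `|l - (\sum_(u <- g) rip (A u) u - \sum_(u <- h) rip (A u) u)| <= (M + 1) * eps.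
Proof.
move=> [P [N [t [pP pN tP tN ->]]]] eps0.
have [g hg] := low_rank_rtr pP tP eps0; have [h hh] := low_rank_rtr pN tN eps0.
exists g, h => A A' M l aA hl.
have [p hp _] := rtr_ex pP tP aA; have [q hq _] := rtr_ex pN tN aA.
have -> : l = p - q by apply: rtr_uniq hl _; apply: (rtr_ext (rtr_sub hp hq)).
have := hg _ _ _ _ aA hp; have := hh _ _ _ _ aA hq.
rewrite !ler_norml => /andP[h1 h2] /andP[h3 h4]; apply/andP; split; lra.
Qed.

Lemma rtr_diff_ex C A A' M : tr_diff C -> adjb A A' M ->
  exists l, rtr (C \o A) l.
Proof.
move=> [P [N [t [pP pN tP tN ->]]]] aA.
have [p hp _] := rtr_ex pP tP aA; have [q hq _] := rtr_ex pN tN aA.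
by exists (p - q); apply: (rtr_ext (rtr_sub hp hq)).
Qed.

Lemma linear_diff C : tr_diff C -> linear C.
Proof.
move=> [P [N [t [[[lP _ _] _] [[lN _ _] _] _ _ ->]]]].
by apply: linear_add => //; exact: linear_opp.
Qed.

Lemma rtr_Tr C A A' M : tr_diff C -> adjb A A' M ->
  rtr (C \o A) (complex.Re (Tr (C \o A))).
Proof.
move=> tC aA; have [l hl] := rtr_diff_ex tC aA.
have [l' hl'] := rtr_diff_ex tC (adjb_i aA).
rewrite (@ReTr _ _ _ l l')//; apply: (rtr_ext hl') => x.
by rewrite /= (linZ (linear_diff tC)).
Qed.

Lemma rtr_Tr_sa C A : tr_diff C -> selfadj A ->
  rtr (C \o A) (complex.Re (Tr (C \o A))).
Proof. by move=> tC /selfadj_adjb[M]; exact: rtr_Tr. Qed.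

End TraceClass.

(** * Weak duality and complementary slackness *)

Section DiffBound.
Variables (R : realType) (H : hilbertType R).
Implicit Types (A B C : H -> H).

Lemma tr_le_sub B C t : tr_diff C -> tr_le B t -> exists s, tr_le (B - C) s.
Proof.
move=> [P [N [s [pP pN tP tN EC]]]] tB; exists (t + s) => F.
rewrite (@le_trans _ _ (ptr (B + N) F))//; last by rewrite ptr_add (lerD (tB F) (tN F)).
apply: ler_sum => e _; have := pP.2 (val e).
by rewrite EC !(addrfctE, opprfctE) !ripE; lra.
Qed.

Lemma ptr_diff_le C A A' M : tr_diff C -> adjb A A' M ->
  exists t, forall F, `|ptr (C \o A) F| <= t.
Proof.
move=> [P [N [s [pP pN tP tN EC]]]] aA; exists ((M + 1) / 2 * s + (M + 1) / 2 * s) => F.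
have -> : ptr (C \o A) F = ptr (P \o A) F - ptr (N \o A) F.
  rewrite /ptr -sumrB; apply: eq_bigr => e _.
  by rewrite EC /= addrfctE opprfctE ripDl ripNl.
rewrite (le_trans (ler_normB _ _))// lerD//.
  exact: ptr_comp_abs_le aA.
exact: ptr_comp_abs_le aA.
Qed.

End DiffBound.

Section Duality.
Variables (R : realType) (H : hilbertType R) (m : nat).
Variables (C : 'I_m -> H -> H) (E : H -> H).
Hypotheses (sC : forall i, selfadj (C i)) (tC : forall i, tr_diff (C i)).
Hypotheses (sE : selfadj E) (EE : forall x, E (E x) = E x).
Hypothesis (CE : forall i x, C i (E x) = C i x).
Implicit Types (x y z u v : H) (a M t eps : R) (A B P N : H -> H).
Implicit Types (D : 'I_m -> H -> H).

Lemma primal_feasibleP D :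
  primal_feasible E D <-> (forall i, psd (D i)) /\ psd (E - \sum_i D i).
Proof.
by split=> -[hD hE]; split=> [i|]; exact/psdP.
Qed.

Lemma dual_feasibleP B : dual_feasible C B <->
  [/\ psd B, exists t, tr_le B t & forall i, psd (B - C i)].
Proof.
split=> [[tB /psdP pB hB]|[pB [t tB] hB]].
  by split; [exact: pB|exact: trace_class_tr_le|move=> i; apply/psdP; exact: hB].
by split; [exact: (psd_trace_class pB tB)|exact/psdP|move=> i; exact/psdP].
Qed.

Lemma primal_valueE D : primal_value C D = \sum_i complex.Re (Tr (C i \o D i)).
Proof. by rewrite /primal_value (big_morph _ (@ReD R) (erefl _)). Qed.

(** Writing [B E = B (E - sum_i D_i) + sum_i B D_i] splits the gap into traces of products of two
    positive operators, one for each slackness equation. *)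
Lemma duality_gap D B : primal_feasible E D -> dual_feasible C B ->
  exists g0 (g : 'I_m -> R), [/\ 0 <= g0, forall i, 0 <= g i,
    dual_value E B - primal_value C D = g0 + \sum_i g i &
    rtr (B \o (E - \sum_i D i)) g0 /\ forall i, rtr ((B - C i) \o D i) (g i)].
Proof.
move=> /primal_feasibleP[pD pS] /dual_feasibleP[pB [t tB] pBC].
have dB := psd_diff pB tB; have [[lB _ _] _] := pB.
have hB A : selfadj A -> rtr (B \o A) (complex.Re (Tr (B \o A))).
  by move=> sA; exact: rtr_Tr_sa.
have hBC i : exists s, tr_le (B - C i) s by exact: tr_le_sub tB.
have h0 := hB _ pS.1.
have hi i : rtr ((B - C i) \o D i)
    (complex.Re (Tr (B \o D i)) - complex.Re (Tr (C i \o D i))).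
  apply: (rtr_ext (rtr_sub (hB _ (pD i).1) (rtr_Tr_sa (tC i) (pD i).1))).
  by [].
exists (complex.Re (Tr (B \o (E - \sum_i D i)))).
exists (fun i => complex.Re (Tr (B \o D i)) - complex.Re (Tr (C i \o D i))).
split => //; first exact: (rtr_psd_ge0 pB tB pS h0).
  by move=> i; have [s ts] := hBC i; exact: (rtr_psd_ge0 (pBC i) ts (pD i) (hi i)).
rewrite primal_valueE sumrB addrA; congr (_ - _).
apply: rtr_uniq (hB _ sE) _.
apply: (rtr_ext (rtr_add h0 (rtr_sum (fun i => hB _ (pD i).1)))) => x.
pose S := \sum_i D i.
rewrite -[LHS]/(B ((E - S) x) + (\sum_i (B \o D i)) x).
have -> : (\sum_i (B \o D i)) x = B (S x) by rewrite /S !fct_sumE (lin_sum lB).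
by rewrite -(linD lB); congr B; rewrite addrfctE opprfctE subrK.
Qed.

Lemma weak_duality D B : primal_feasible E D -> dual_feasible C B ->
  primal_value C D <= dual_value E B.
Proof.
move=> pD dB; have [g0 [g [h0 hg hs _]]] := duality_gap pD dB.
by rewrite -subr_ge0 hs addr_ge0// sumr_ge0.
Qed.

Lemma slacknessP D B : primal_feasible E D -> dual_feasible C B ->
  complementary_slackness C E D B <-> primal_value C D = dual_value E B.
Proof.
move=> pD dB; have [g0 [g [h0 hg hs [hr0 hrg]]]] := duality_gap pD dB.
move: pD dB => /primal_feasibleP[pD pS] /dual_feasibleP[pB [t tB] pBC].
split=> [[z0 zi]|e0].
  apply/eqP; rewrite eq_sym -subr_eq0 hs; apply/eqP.
  rewrite (rtr_uniq hr0 (l' := 0)); last by rewrite z0; exact: rtr0.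
  rewrite add0r big1// => i _; apply: rtr_uniq (hrg i) _.
  by rewrite zi; exact: rtr0.
have g1 : 0 <= \sum_i g i by exact: sumr_ge0.
have g00 : g0 = 0 by move: hs; rewrite e0 subrr; lra.
have gi0 i : g i = 0.
  have gs : \sum_i g i = 0 by move: hs; rewrite e0 subrr; lra.
  by apply/eqP; move/eqP: gs; rewrite psumr_eq0// => /allP/(_ i); rewrite mem_index_enum => /(_ isT).
split.
  by apply: funext => x; apply: (rtr_psd_eq0 pB tB pS); rewrite -g00.
move=> i; apply: funext => x.
have [s ts] := tr_le_sub (tC i) tB.
apply: (rtr_psd_eq0 (pBC i) ts (pD i)).
by rewrite -(gi0 i).
Qed.

End Duality.

(** * Weak limits and existence of an optimal primal solution *)

Section Attain.
Variables (R : realType) (H : hilbertType R).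
Implicit Types (x y z u v : H) (a M t eps : R) (A B P N : H -> H).

Lemma ultra_lim (U : set_system nat) (f : nat -> R) M : UltraFilter U ->
  (forall n, `|f n| <= M) -> exists l : R, f @ U --> l.
Proof.
move=> uU hf; have pU := @ultra_proper nat U uU.
have [|l [_ cl]] := @segment_compact R (- M) M (f @ U) _.
  apply: (@filterE _ U) => n; rewrite /preimage /= in_itv /= -ler_norml; exact: hf.
exists l => V nV; have [//|nU] := in_ultra_setVsetC (f @^-1` V) uU.
by have [x [/= nx Vx]] := cl (~` V) V nU nV.
Qed.

Lemma cvg_sumr (X : Type) (U : set_system X) (I : Type) (r : seq I)
    (f : I -> X -> R) (l : I -> R) : Filter U ->
  (forall i, f i @ U --> l i) ->
  (fun n => \sum_(i <- r) f i n) @ U --> \sum_(i <- r) l i.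
Proof.
move=> FU hf; elim: r => [|i r IH].
  by under eq_fun do rewrite big_nil; rewrite big_nil; exact: cvg_cst.
by under eq_fun do rewrite big_cons; rewrite big_cons; apply: cvgD.
Qed.

Lemma rip_conj (c : R[i]) x y : rip (c *: x) y = rip x (c^*%C *: y).
Proof.
rewrite /rip linearZl_LR linearZr_LR /=.
by case: c => p q; case: '[x, y] => r s /=; ring.
Qed.

(* Bounded forms converge along an ultrafilter, and Riesz' theorem turns the limit
   form back into an operator. *)
Lemma weak_limit (U : set_system nat) (D : nat -> H -> H) : UltraFilter U ->
  (forall n, psd (D n)) -> (forall n x, rip (D n x) x <= rip x x) ->
  exists L, psd L /\ forall x y, rip (D n x) y @[n --> U] --> rip (L x) y.
Proof.
move=> uU pD D1; have pU := @ultra_proper nat U uU.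
have D2 n x : rip (D n x) (D n x) <= rip x x.
  have := @psd_norm_le R H (D n) 1 x (pD n); rewrite mul1r => /(_ _)/le_trans; apply.
    by move=> y; rewrite mul1r.
  exact: D1.
have D3 n x y : 2 * rip (D n x) y <= rip x x + rip y y.
  by have := rip_amgm (D n x) y ltr01; rewrite invr1; have := D2 n x; lra.
have ex x y : exists l : R, rip (D n x) y @[n --> U] --> l.
  apply: (@ultra_lim _ _ ((rip x x + rip y y) / 2)) => // n.
  have := D3 n x y; have := D3 n x (- y); rewrite !ripE opprK ler_norml => h1 h2.
  by apply/andP; split; lra.
have uq (f : nat -> R) (l l' : R) : f @ U --> l -> f @ U --> l' -> l = l'.
  by move=> /cvg_lim h1 /cvg_lim h2; rewrite -h1// -h2.
have le (f : nat -> R) (l k : R) : f @ U --> l -> (forall n, f n <= k) -> l <= k.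
  move=> hf fk; have <- := cvg_lim (@Rhausdorff R) hf.
  by apply: limr_le; [apply/cvg_ex; exists l|exact: nearW].
have [b hb] : {b : H -> H -> R & forall x y, rip (D n x) y @[n --> U] --> b x y}.
  have [b hb] := choice (fun p : H * H => ex p.1 p.2).
  by exists (fun x y => b (x, y)) => x y; exact: (hb (x, y)).
have [L hL] : {L : H -> H & forall x y, rip (L x) y = b x y}.
  apply: (@choice _ _ (fun x z => forall y, rip z y = b x y)) => x; apply: (@riesz R H (b x) (rip x x)).
  - move=> y z; apply: uq (hb x (y + z)) _.
    under eq_fun do rewrite ripDr.
    exact: cvgD (hb x y) (hb x z).
  - move=> a y; apply: uq (hb x (a%:C *: y)) _.
    under eq_fun do rewrite ripZr.
    exact: cvgMr (hb x y).
  - move=> y; apply: (le (fun n => 2 * rip (D n x) y)); first exact: cvgMr (hb x y).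
    by move=> n; exact: D3.
have cL x y : rip (D n x) y @[n --> U] --> rip (L x) y by rewrite hL.
exists L; split => //; split; last first.
  move=> x; rewrite -oppr_le0; apply: (le (fun n => - rip (D n x) x)); first exact: cvgN.
  by move=> n; rewrite oppr_le0; exact: (pD n).2.
split.
- move=> c x y; apply: rip_inj => z; apply: uq (cL _ z) _.
  rewrite ripDl rip_conj.
  rewrite (_ : (fun n => _) = (fun n => rip (D n x) (c^*%C *: z)) + (fun n => rip (D n y) z)).
    by apply: cvgD.
  apply: funext => n; have [[lD _ _] _] := pD n.
  by rewrite lD ripDl rip_conj.
- exists 1 => // x; rewrite mul1r.
  (* Testing the limit form at [y = L x] lets half of the left side be absorbed. *)
  suff : 2 * rip (L x) (L x) <= rip x x + rip (L x) (L x) by lra.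
  by apply: (le (fun n => 2 * rip (D n x) (L x))); [exact: cvgMr|move=> n; exact: D3].
- move=> x y; rewrite [RHS]ripC; apply: uq (cL x y) _.
  rewrite (_ : (fun n => _) = (fun n => rip (D n y) x)); first exact: cL.
  by apply: funext => n; have [[_ _ aD] _] := pD n; rewrite aD ripC.
Qed.

End Attain.

Section Optimal.
Variables (R : realType) (H : hilbertType R) (m : nat).
Variables (C : 'I_m -> H -> H) (E : H -> H).
Hypotheses (sC : forall i, selfadj (C i)) (tC : forall i, tr_diff (C i)).
Hypotheses (sE : selfadj E) (EE : forall x, E (E x) = E x).
Hypothesis (CE : forall i x, C i (E x) = C i x).
Implicit Types (x y z u v : H) (a M t eps : R) (A B P N : H -> H).
Implicit Types (D : 'I_m -> H -> H).

Lemma psd_proj : psd E.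
Proof.
by split=> // x; have [_ _ aE] := sE; rewrite -[E x]EE aE rip_ge0.
Qed.

Lemma proj_form_le x : rip (E x) x <= rip x x.
Proof.
have [_ _ aE] := sE; have := rip_ge0 (x - E x).
have e1 : rip (E x) (E x) = rip (E x) x by rewrite -aE EE.
by rewrite !ripE e1 (ripC x (E x)); lra.
Qed.

Lemma feasible_form_le D i x : primal_feasible E D -> rip (D i x) x <= rip (E x) x.
Proof.
move=> /primal_feasibleP[pD pS]; have := pS.2 x.
rewrite addrfctE opprfctE fct_sumE ripDl ripNl (bigD1 i)//= ripDl.
have : 0 <= rip (\sum_(j < m | j != i) D j x) x.
  have := (psd_sum (index_enum 'I_m) (fun j => j != i) pD).2 x.
  by rewrite fct_sumE.
lra.
Qed.

Lemma feasible_adjb D i : primal_feasible E D -> adjb (D i) (D i) 1.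
Proof.
move=> fD; have [pD pS] := (primal_feasibleP _ _).1 fD.
have h x : rip (D i x) (D i x) <= 1 * rip x x.
  have hb y : rip (D i y) y <= 1 * rip y y.
    by rewrite mul1r (le_trans (feasible_form_le i y fD))// proj_form_le.
  rewrite (le_trans (psd_norm_le x (pD i) hb))// mul1r; exact: hb.
by have [[lD _ aD] _] := pD i; split.
Qed.

Lemma feasible0 : primal_feasible E (fun _ : 'I_m => 0).
Proof.
apply/primal_feasibleP; split=> [i|]; first exact: psd0.
by rewrite big1// subr0; exact: psd_proj.
Qed.

Lemma low_rank_value eps : 0 < eps -> exists (g h : 'I_m -> seq H),
  forall D, primal_feasible E D ->
  `|primal_value C D - \sum_i (\sum_(u <- g i) rip (D i u) u -
       \sum_(u <- h i) rip (D i u) u)| <= m%:R * (2 * eps).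
Proof.
move=> eps0.
have [gh hgh] := choice (fun i => let: ex_intro g (ex_intro h k) := low_rank_diff (tC i) eps0 in
  ex_intro (fun p : seq H * seq H => forall A A' M l, adjb A A' M -> rtr (C i \o A) l ->
    `|l - (\sum_(u <- p.1) rip (A u) u - \sum_(u <- p.2) rip (A u) u)| <= (M + 1) * eps) (g, h) k).
exists (fun i => (gh i).1), (fun i => (gh i).2) => D fD.
rewrite primal_valueE -sumrB (le_trans (ler_norm_sum _ _ _))//.
rewrite (@le_trans _ _ (\sum_(i < m) (1 + 1) * eps))//; last first.
  by rewrite sumr_const card_ord -[leLHS]mulr_natl.
apply: ler_sum => i _; apply: (hgh i) (feasible_adjb i fD) _.
exact: rtr_Tr (feasible_adjb i fD).
Qed.

Lemma primal_attained : exists2 D, primal_feasible E D &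
  forall D', primal_feasible E D' -> primal_value C D' <= primal_value C D.
Proof.
pose V := [set primal_value C D | D in primal_feasible E].
have V_sup : has_sup V.
  split; first by exists (primal_value C (fun=> 0)), (fun=> 0) => //; exact: feasible0.
  (* Precision 1 already bounds the values: the entries along [g] are at most [rip u u], and those
     along [h] are only subtracted. *)
  have [g [h gh]] := low_rank_value ltr01.
  exists (m%:R * (2 * 1) + \sum_i (\sum_(u <- g i) rip u u)) => _ [D fD <-].
  have := gh D fD; rewrite ler_norml => /andP[_].
  rewrite lerBlDr => /le_trans; apply; rewrite lerD2l.
  have [pD _] := (primal_feasibleP _ _).1 fD.
  apply: ler_sum => i _; rewrite lerBlDr ler_wpDr//.
    by apply: sumr_ge0 => u _; exact: (pD i).2.
  apply: ler_sum => u _; apply: le_trans (feasible_form_le i u fD) _.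
  exact: proj_form_le.
pose s := sup V.
have [Dn hDn] : {Dn : nat -> 'I_m -> H -> H & forall n,
    primal_feasible E (Dn n) /\ s - n.+1%:R^-1 < primal_value C (Dn n)}.
  apply: (@choice _ _ (fun n D => primal_feasible E D /\
    s - n.+1%:R^-1 < primal_value C D)) => n.
  have n0 : 0 < n.+1%:R^-1 :> R by rewrite invr_gt0.
  by have [_ [D fD <-] h] := sup_adherent n0 V_sup; exists D.
(* One ultrafilter makes all matrix entries converge at once, where a diagonal subsequence would
   call for a separable [H]. *)
have [U [uU UF]] := ultraFilterLemma (@eventually_filter).
have pU := @ultra_proper nat U uU.
have fDn n := (hDn n).1.
have pDn n : (forall i, psd (Dn n i)) /\ psd (E - \sum_i Dn n i).
  exact/primal_feasibleP.
have [L hL] : {L : 'I_m -> H -> H & forall i, psd (L i) /\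
    forall x y, rip (Dn n i x) y @[n --> U] --> rip (L i x) y}.
  apply: (@choice _ _ (fun i Li => psd Li /\
    forall x y, rip (Dn n i x) y @[n --> U] --> rip (Li x) y)) => i.
  apply: weak_limit => // [n|n x]; first exact: (pDn n).1.
  by rewrite (le_trans (feasible_form_le i x (fDn n)))// proj_form_le.
have lim_le (f : nat -> R) (l k : R) : f @ U --> l -> (forall n, f n <= k) -> l <= k.
  move=> hf fk; have <- := cvg_lim (@Rhausdorff R) hf.
  by apply: limr_le; [apply/cvg_ex; exists l|exact: nearW].
have fL : primal_feasible E L.
  apply/primal_feasibleP; split=> [i|]; first exact: (hL i).1.
  split=> [|x]; first by apply: selfadj_sub => //; apply: selfadj_sum => i; exact: (hL i).1.1.
  rewrite addrfctE opprfctE fct_sumE ripDl ripNl subr_ge0.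
  apply: (lim_le (fun n => rip ((\sum_i Dn n i) x) x)); last first.
    by move=> n; have := (pDn n).2.2 x; rewrite addrfctE opprfctE ripDl ripNl subr_ge0.
  rewrite /rip linear_sumlz (big_morph _ (@ReD R) (erefl _)).
  rewrite (_ : (fun n => _) = fun n => \sum_i rip (Dn n i x) x).
    by apply: cvg_sumr => i; exact: (hL i).2.
  apply: funext => n; rewrite fct_sumE linear_sumlz (big_morph _ (@ReD R) (erefl _)).
  by [].
exists L => // D' fD'.
apply: (@le_trans _ _ s); first by apply: sup_upper_bound => //; exists D'.
apply/ler_addgt0Pr => eps eps0.
(* One [d] pays for the near-optimality of [Dn n], and [2 * m * d] is paid twice for finite rank
   approximation, at [Dn n] and at [L]. *)
pose d := eps / (1 + 4 * m%:R).
have m1 : 0 < 1 + 4 * m%:R :> R by rewrite ltr_wpDr// mulr_ge0.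
have d0 : 0 < d by rewrite divr_gt0.
have [g [h gh]] := low_rank_value d0.
pose q D := \sum_i (\sum_(u <- g i) rip (D i u) u - \sum_(u <- h i) rip (D i u) u).
have qL : q (Dn n) @[n --> U] --> q L.
  apply: cvg_sumr => i; apply: cvgB; apply: cvg_sumr => u; exact: (hL i).2.
have : s - d - m%:R * (2 * d) <= q L.
  have <- := cvg_lim (@Rhausdorff R) qL.
  apply: limr_ge; first by apply/cvg_ex; exists (q L).
  apply: UF; have [N _ hN] := near_infty_natSinv_lt (PosNum d0).
  exists N => // n /= Nn; have := hN n Nn; rewrite /= => nd.
  have := gh _ (fDn n); rewrite ler_norml => /andP[_].
  have [_] := hDn n; rewrite -/(q (Dn n)).
  move: nd; move: (n.+1%:R^-1) => j; lra.
have := gh _ fL; rewrite -/(q L) ler_norml => /andP[h1 h2] h3.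
have : eps = d + 4 * (m%:R * d) by rewrite /d; field; lra.
lra.
Qed.

End Optimal.

(** * The dual solution attached to an optimal primal solution *)

Lemma small_perturbation (R : realType) (a b d : R) : 0 < d ->
  (forall e, 0 < e -> e <= d -> e * a + e ^+ 2 * b <= 0) -> a <= 0.
Proof.
move=> d0 h; rewrite leNgt; apply/negP => a0.
pose e := Num.min d (a / (2 * (`|b| + 1))).
have b1 : 0 < 2 * (`|b| + 1) by have := normr_ge0 b; lra.
have e0 : 0 < e by rewrite lt_min d0 divr_gt0.
have ea : e * (2 * (`|b| + 1)) <= a.
  by rewrite -ler_pdivlMr// ge_min lexx orbT.
have := h e e0; rewrite {1}/e ge_min lexx => /(_ isT).
rewrite expr2 -mulrA -mulrDr pmulr_rle0// => h1.
have := ler_norm (- b); rewrite normrN => nb.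
have h2 : e * (- b) <= e * `|b| by rewrite ler_pM2l.
nra.
Qed.

Section DualOptimal.
Variables (R : realType) (H : hilbertType R) (m : nat).
Variables (C : 'I_m -> H -> H) (E : H -> H).
Hypotheses (sC : forall i, selfadj (C i)) (tC : forall i, tr_diff (C i)).
Hypotheses (sE : selfadj E) (EE : forall x, E (E x) = E x).
Hypothesis (CE : forall i x, C i (E x) = C i x).
Implicit Types (x y z u v : H) (a M t eps : R) (A B P N : H -> H).
Implicit Types (D : 'I_m -> H -> H).

Lemma psd_conj S B : selfadj S -> psd B -> psd (S \o B \o S).
Proof.
move=> [lS bS aS] [[lB bB aB] pB]; split.
  split; [by apply: linear_comp => //; apply: linear_comp|by do 2 apply: bdd_comp => //|].
  by move=> x y; rewrite /= aS aB aS.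
by move=> x; rewrite /= aS.
Qed.

Lemma psd_scale B a : 0 <= a -> psd B -> psd (fun x => a%:C *: B x).
Proof.
move=> a0 [sB pB]; split; first exact: selfadj_scale.
by move=> x; rewrite ripZl mulr_ge0.
Qed.

(** As [0 <= D i <= E], the form of [D i] vanishes on the kernel of [E], which contains
    [x - E x]. *)
Lemma feasible_proj D i x : primal_feasible E D -> D i (E x) = D i x.
Proof.
move=> fD; have [pD _] := (primal_feasibleP _ _).1 fD.
have [[lD _ _] pDi] := pD i; have [lE _ _] := sE.
have z : D i (x - E x) = 0.
  apply: psd_eq0 => //; apply/eqP; rewrite eq_le pDi andbT.
  apply: le_trans (feasible_form_le i _ fD) _.
  by rewrite (linD lE) (linN lE) EE subrr rip0l.
by apply/esym/eqP; rewrite -subr_eq0 -(linN lD) -(linD lD) z.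
Qed.

Section Perturb.
Variables (D : 'I_m -> H -> H) (x : H) (w : 'I_m -> R) (e : R).
Hypotheses (fD : primal_feasible E D) (Ex : E x = x) (e0 : 0 < e).
Hypotheses (eq2 : e * rip x x <= 2) (w0 : forall i, 0 <= w i) (w1 : \sum_i w i <= 1).

Let K := rank1 x x.
Let S : H -> H := id - (fun y => e%:C *: K y).
(* chosen so that [E - S \o E \o S = c K] *)
Let c := e * (2 - e * rip x x).

Definition perturb i : H -> H := S \o D i \o S + (fun y => (w i * c)%:C *: K y).

Let SE y : S y = y - (e%:C * '[y, x]) *: x.
Proof. by rewrite /S addrfctE opprfctE /K /rank1 scalerA. Qed.

Let sS : selfadj S.
Proof. by apply: selfadj_sub; [exact: selfadj_id|exact/selfadj_scale/selfadj_rank1]. Qed.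

Let c0 : 0 <= c.
Proof. by rewrite /c mulr_ge0 ?(ltW e0)// subr_ge0. Qed.

(** The congruence turns [sum_i D_i <= E] into [S (sum_i D_i) S <= S E S = E - c K], and the weights
    hand out at most the freed [c K]. *)
Lemma perturb_feasible : primal_feasible E perturb.
Proof.
have [pD pS] := (primal_feasibleP _ _).1 fD; have [lE _ aE] := sE.
have [lS _ _] := sS.
apply/primal_feasibleP; split=> [i|].
  apply: psd_add; first exact: psd_conj.
  by apply: psd_scale; [exact: mulr_ge0|exact: psd_rank1].
have -> : E - \sum_i perturb i = S \o (E - \sum_i D i) \o S +
    (fun y => ((1 - \sum_i w i) * c)%:C *: K y).
  apply: funext => y; rewrite !addrfctE !opprfctE /= fct_sumE.
  have -> : \sum_i perturb i y = S ((\sum_i D i) (S y)) + ((\sum_i w i) * c)%:C *: K y.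
    rewrite /perturb big_split /= fct_sumE (lin_sum lS); congr (_ + _).
    by rewrite -scaler_suml mulr_suml rmorph_sum.
  rewrite (linD lS) (linN lS).
  have -> : S (E (S y)) = E y - c%:C *: K y.
    rewrite !SE (linD lE) (linN lE) (linZ lE) Ex.
    rewrite linearBl linearZl_LR /= (inner_adj lE aE) Ex innerxx /K /rank1.
    rewrite -addrA -opprD -scalerDl scalerA; congr (_ - _ *: _).
    by rewrite /c !rmorphM rmorphB rmorphM /= -[2%:C]/(2%:R%:C) rmorph_nat; ring.
  rewrite mulrBl mul1r rmorphB scalerBl.
  rewrite addrACA; rewrite opprD; congr (_ + _).
  by rewrite /= subrK.
apply: psd_add; first exact: psd_conj.
apply: psd_scale; last exact: psd_rank1.
by rewrite mulr_ge0// subr_ge0.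
Qed.

(** The change in [D i] is a combination of rank one operators built from [x] and [D i x], so its
    trace against [C i] is explicit and the value is an exact quadratic polynomial in [e]. *)
Lemma perturb_value : primal_value C perturb = primal_value C D
   + e * (2 * (\sum_i w i * rip (C i x) x - \sum_i rip (C i (D i x)) x))
   + e ^+ 2 * \sum_i (rip (D i x) x - w i * rip x x) * rip (C i x) x.
Proof.
have [pD pS] := (primal_feasibleP _ _).1 fD.
have [pP _] := (primal_feasibleP _ _).1 perturb_feasible.
rewrite !primal_valueE !mulr_sumr -sumrB !mulr_sumr -!big_split /=.
apply: eq_bigr => i _.
have [[lD _ aD] _] := pD i; have [lC _ aC] := sC i.
apply: rtr_uniq (rtr_Tr_sa (tC i) (pP i).1) _.
(* Total coefficient of [K]: [K D_i K] equals [rip (D i x) x] times [K], and the added term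
   contributes [w i * c]. *)
pose k := e ^+ 2 * rip (D i x) x + w i * c.
have h1 := rtr_Tr_sa (tC i) (pD i).1.
have h2 := rtr_scale (a := e) (rtr_rank1 (u := D i x) (v := x) lC).
have h3 := rtr_scale (a := e) (rtr_rank1 (u := x) (v := D i x) lC).
have h4 := rtr_scale (a := k) (rtr_rank1 (u := x) (v := x) lC).
have h := rtr_add (rtr_sub (rtr_sub h1 h2) h3) h4.
rewrite [X in rtr _ X](_ : _ = complex.Re (Tr (C i \o D i)) - e * rip (C i (D i x)) x
  - e * rip (C i x) (D i x) + k * rip (C i x) x); last first.
  have e1 : rip (C i x) (D i x) = rip (C i (D i x)) x by rewrite aC ripC.
  by rewrite e1 /k /c; ring.
apply: (rtr_ext h) => y.
rewrite !addrfctE !opprfctE /perturb /rank1 /= addrfctE /= /K /rank1.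
rewrite -!(linZ lC) -!(linN lC) -!(linD lC); congr (C i).
rewrite !SE (linD lD) (linN lD) (linZ lD) linearBl linearZl_LR /=.
rewrite (inner_adj lD aD) (inner_selfadj _ (pD i).1).
rewrite !scalerA -!addrA; congr (_ + _).
have sub (a b : R[i]) : - (a *: x) + b *: x = (b - a) *: x by rewrite scalerBl addrC.
congr (_ + _); rewrite !sub; congr (_ *: _).
rewrite /k expr2 !rmorphD !rmorphM /=; ring.
Qed.

End Perturb.

Lemma optimal_form_le D x (w : 'I_m -> R) : primal_feasible E D ->
  (forall D', primal_feasible E D' -> primal_value C D' <= primal_value C D) ->
  (forall i, 0 <= w i) -> \sum_i w i <= 1 ->
  \sum_i w i * rip (C i x) x <= \sum_i rip (C i (D i x)) x.
Proof.
move=> fD opt w0 w1.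
(* The perturbation requires a vector fixed by [E]; neither side changes when [x] is replaced by
   [E x]. *)
have cE i : rip (C i (E x)) (E x) = rip (C i x) x.
  by have [_ _ aC] := sC i; rewrite CE aC CE -aC.
have dE i : rip (C i (D i (E x))) (E x) = rip (C i (D i x)) x.
  by have [_ _ aC] := sC i; rewrite (feasible_proj i x fD) aC CE -aC.
under eq_bigr do rewrite -cE; under [leRHS]eq_bigr do rewrite -dE.
rewrite -subr_le0 -(@pmulr_rle0 _ 2)//.
have q0 := rip_ge0 (E x).
pose b := \sum_i (rip (D i (E x)) (E x) - w i * rip (E x) (E x)) * rip (C i (E x)) (E x).
have d0 : 0 < 2 / (rip (E x) (E x) + 1) by rewrite divr_gt0//; lra.
apply: (small_perturbation (b := b) d0) => e e0.
rewrite ler_pdivlMr; last by lra.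
move=> ed; have e2 : e * rip (E x) (E x) <= 2 by lra.
have := opt _ (perturb_feasible fD (EE x) e0 e2 w0 w1).
rewrite (perturb_value fD (EE x) e0 e2 w0 w1) -/b; lra.
Qed.

(* The Lagrange multiplier is the symmetrized operator [sum_i C_i D_i]. *)
Lemma dual_of_optimal D : primal_feasible E D ->
  (forall D', primal_feasible E D' -> primal_value C D' <= primal_value C D) ->
  exists2 B, dual_feasible C B & dual_value E B = primal_value C D.
Proof.
move=> fD opt; have [pD pS] := (primal_feasibleP _ _).1 fD.
pose X i : H -> H := (C i \o D i) + (D i \o C i).
pose B : H -> H := fun x => (2^-1)%:C *: (\sum_i X i) x.
have formB x : rip (B x) x = \sum_i rip (C i (D i x)) x.
  rewrite /B ripZl fct_sumE /rip linear_sumlz (big_morph _ (@ReD R) (erefl _)).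
  rewrite mulr_sumr; apply: eq_bigr => i _; rewrite -!/(rip _ _) /X addrfctE ripDl /=.
  have [[_ _ aD] _] := pD i; have [_ _ aC] := sC i.
  have -> : rip (D i (C i x)) x = rip (C i (D i x)) x by rewrite aD ripC aC.
  by lra.
have sX i : selfadj (X i).
  have [[lD bD aD] _] := pD i; have [lC bC aC] := sC i; split.
  - by apply: linear_add; exact: linear_comp.
  - by apply: bdd_add; exact: bdd_comp.
  - by move=> x y; rewrite /X !addrfctE /= ripDl ripDr aC aD aD aC addrC.
have sB : selfadj B by apply: selfadj_scale; exact: selfadj_sum.
have pB : psd B.
  split=> // x; rewrite formB.
  have w1 : \sum_(i < m) 0 <= 1 :> R by rewrite big1 ?ler01.
  have := @optimal_form_le D x (fun=> 0) fD opt (fun=> lexx _) w1.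
  by rewrite big1// => i _; rewrite mul0r.
have pBC j : psd (B - C j).
  split=> [|x]; first exact: selfadj_sub.
  rewrite addrfctE opprfctE ripDl ripNl subr_ge0 formB.
  have w1 : \sum_(i < m) (i == j)%:R <= 1 :> R.
    by rewrite (bigD1 j)//= eqxx big1 ?addr0// => i /negbTE->.
  have := @optimal_form_le D x (fun i => (i == j)%:R) fD opt (fun=> ler0n _ _) w1.
  by rewrite (bigD1 j)//= eqxx mul1r big1 ?addr0// => i /negbTE->; rewrite mul0r.
have ptrB F : ptr B F = \sum_i ptr (C i \o D i) F.
  by rewrite /ptr exchange_big; apply: eq_bigr => e _; exact: formB.
have [s hs] : {s : 'I_m -> R & forall i F, `|ptr (C i \o D i) F| <= s i}.
  apply: (@choice _ _ (fun i s => forall F, `|ptr (C i \o D i) F| <= s)) => i.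
  exact: ptr_diff_le (tC i) (feasible_adjb sE EE i fD).
have tB : tr_le B (\sum_i s i).
  move=> F; rewrite ptrB; apply: ler_sum => i _.
  by rewrite (le_trans (ler_norm _)).
exists B; first by apply/dual_feasibleP; split=> //; exists (\sum_i s i).
apply: rtr_uniq (rtr_Tr_sa (psd_diff pB tB) sE) _.
(* Hence the dual value is the trace of [B], whose partial sums are those of [sum_i C_i D_i]:
   symmetrizing leaves the real diagonal unchanged. *)
have BE : B \o E = B.
  apply: funext => x; rewrite /B /= !fct_sumE; congr (_ *: _).
  by apply: eq_bigr => i _; rewrite /X !addrfctE /= CE (feasible_proj _ _ fD).
rewrite BE /rtr (_ : ptr B = fun F => \sum_i ptr (C i \o D i) F); last exact: funext.
rewrite primal_valueE; apply: cvg_sumr => i.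
exact: rtr_Tr_sa (pD i).1.
Qed.

End DualOptimal.

(** * Strong duality and the optimality conditions *)

Theorem theorem2 (R : realType) (H : hilbertType R) (m : nat) (hm : (0 < m)%N)
    (Rop : 'I_m -> H -> H) (P0 : H -> H) (C : 'I_m -> H -> H) (E : H -> H)
    (hR : forall i, positive_op (Rop i)) (hP0 : positive_op P0)
    (hC : forall i, C i = Rop i - P0)
    (hCtr : forall i, trace_class (C i))
    (hE : orthogonal_projection E)
    (hCE : forall i, C i \o E = C i) :
  (forall D : 'I_m -> H -> H, primal_feasible E D ->
     ((primal_value C D)%:E = kappa_o C E <->
      exists B : H -> H,
        dual_feasible C B /\ complementary_slackness C E D B)) /\
  ((forall (D : 'I_m -> H -> H) (B : H -> H),
      primal_feasible E D -> dual_feasible C B ->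
      complementary_slackness C E D B ->
      (dual_value E B)%:E = bracket_plus C E) /\
   (forall B : H -> H, dual_feasible C B ->
      ((dual_value E B)%:E = bracket_plus C E <->
       exists D : 'I_m -> H -> H,
         primal_feasible E D /\ complementary_slackness C E D B))) /\
  kappa_o C E = bracket_plus C E.
Proof.
have sP0 := ((psdP _).1 hP0).1.
have sC i : selfadj (C i).
  by rewrite hC; apply: selfadj_sub => //; exact: ((psdP _).1 (hR i)).1.
have tC i : tr_diff (C i) by exact: trace_class_diff.
have [bE hermE idE] := hE.
have sE : selfadj E by exact/selfadjP.
have EE x : E (E x) = E x by rewrite -[LHS]/((E \o E) x) idE.
have CE i x : C i (E x) = C i x by rewrite -[LHS]/((C i \o E) x) hCE.
have weak D B : primal_feasible E D -> dual_feasible C B ->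
    primal_value C D <= dual_value E B.
  exact: weak_duality.
have slack D B : primal_feasible E D -> dual_feasible C B ->
    complementary_slackness C E D B <-> primal_value C D = dual_value E B.
  exact: slacknessP.
have kappaP D : primal_feasible E D ->
    (forall D', primal_feasible E D' -> primal_value C D' <= primal_value C D) ->
    (primal_value C D)%:E = kappa_o C E.
  move=> fD opt; apply/eqP; rewrite eq_le; apply/andP; split.
    by apply: ereal_sup_ubound; exists D.
  by apply: ge_ereal_sup => _ [D' fD' <-]; rewrite lee_fin opt.
have bracketP D B : primal_feasible E D -> dual_feasible C B ->
    primal_value C D = dual_value E B -> (dual_value E B)%:E = bracket_plus C E.
  move=> fD fB eDB; apply/eqP; rewrite eq_le; apply/andP; split.
    by apply: le_ereal_inf_tmp => _ [B' fB' <-]; rewrite lee_fin -eDB weak.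
  by apply: ereal_inf_lbound; exists B.
have [D0 fD0 opt0] := primal_attained tC sE EE.
have [B0 fB0 eB0] := dual_of_optimal sC tC sE EE CE fD0 opt0.
split; [|split; [split|]].
- move=> D fD; split=> [Dk|[B [fB /(slack _ _ fD fB) eDB]]].
    have opt D' : primal_feasible E D' -> primal_value C D' <= primal_value C D.
      by move=> fD'; rewrite -lee_fin Dk; apply: ereal_sup_ubound; exists D'.
    have [B fB eB] := dual_of_optimal sC tC sE EE CE fD opt.
    by exists B; split => //; apply/slack.
  by apply: kappaP => // D' fD'; rewrite eDB weak.
- by move=> D B fD fB /(slack _ _ fD fB); exact: bracketP.
- move=> B fB; split=> [Bk|[D [fD /(slack _ _ fD fB)]]]; last exact: bracketP.
  (* Slackness depends only on equality of the two values, so one primal optimum certifies every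
     dual optimum. *)
  exists D0; split => //; apply/slack => //.
  by apply/EFin_inj; rewrite Bk -eB0; exact: bracketP (esym eB0).
- by rewrite -(kappaP _ fD0 opt0) -eB0; exact: bracketP (esym eB0).
Qed.
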